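(* Let $d\in\{2,3\}$. There exist positive constants $c_1,c_2$ (independent of the simplex) such that the following holds. For any $d$-simplex $T_0\in\mathbb T_h$, let $T$ be the standard position of $T_0$, obtained from $T_0$ by appropriate rotation, translation, and mirror imaging. Then $$c_1H_{T_0}\le H_T\le c_2H_{T_0}.$$ Furthermore, in the case $d=2$, $H_{T_0}$ is equivalent to the circumradius $R_{T_0}$ of $T_0$; that is, there exist positive constants $c_3,c_4$ (independent of $T_0$) with $c_3R_{T_0}\le H_{T_0}\le c_4R_{T_0}$. Furthermore, in the case $d=2$, the condition $H_{T_0}/h_{T_0}<\infty$ (i.e. $H_{T_0}/h_{T_0}$ is bounded by a constant uniformly over all $T_0$ in the family of meshes) implies the semiregularity condition (there is a constant $C>0$ with $R_{T_0}\le C\,h_{T_0}$ for all $T_0$ in the family), which is equivalent to the maximum-angle condition (there is a constant $\delta_{\max}\in(0,\pi)$ such that the maximum angle of every $T_0$ in the family is at most $\delta_{\max}$).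
   Context: Let $\Omega\subset\mathbb R^d$ be a bounded polyhedral domain and $\mathbb T_h$ a simplicial mesh of $\overline\Omega$ made up of closed $d$-simplices, without hanging nodes (each face of a simplex is either a subset of $\partial\Omega$ or a face of another simplex of the mesh). For $T_0\in\mathbb T_h$, $h_{T_0}:=\mathrm{diam}(T_0)$, $|T_0|$ is the measure of $T_0$, and, with $L_i$ denoting the edges of $T_0$ and $|L_i|$ their lengths, $$H_{T_0}:=\frac{h_{T_0}^2}{|T_0|}\min_{1\le i\le3}|L_i|\ \ (d=2),\qquad H_{T_0}:=\frac{h_{T_0}^2}{|T_0|}\min_{1\le i,j\le6,\ i\ne j}|L_i||L_j|\ \ (d=3).$$ Standard positions. Case $d=2$: for $\alpha_1,\alpha_2>0$ and $s^2+t^2=1$, $t>0$, let $T$ be the triangle with vertices $x_1=(0,0)^T$, $x_2=(\alpha_1,0)^T$, $x_3=(\alpha_2 s,\alpha_2 t)^T$. $T$ is in standard position if the edge $\overline{x_2x_3}$ is a longest edge of $T$ and $\alpha_2\le\alpha_1$. Case $d=3$: let $\alpha_1,\alpha_2,\alpha_3>0$ and $s_1^2+t_1^2=1$, $s_1>0$, $t_1>0$, $\alpha_2s_1\le\alpha_1/2$, $s_{21}^2+s_{22}^2+t_2^2=1$, $t_2>0$, $\alpha_3s_{21}\le\alpha_1/2$. Let $T$ be the tetrahedron with vertices $x_1=(0,0,0)^T$, $x_2=(\alpha_1,0,0)^T$, $x_4=(\alpha_3s_{21},\alpha_3s_{22},\alpha_3t_2)^T$, and $x_3=(\alpha_2s_1,\alpha_2t_1,0)^T$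 (Type i) or $x_3=(\alpha_1-\alpha_2s_1,\alpha_2t_1,0)^T$ (Type ii). Let $L_{\min}$ be an edge of $T$ of minimum length and $L_{\max}^{(\min)}$ a longest edge among the four edges sharing an end point with $L_{\min}$. $T$ is in standard position if $x_1,x_2$ are the end points of $L^{(\min)}_{\max}$ (so $\alpha_1=|L_{\max}^{(\min)}|$) and, with respect to the plane through the midpoint of $\overline{x_1x_2}$ perpendicular to $x_1-x_2$: in Type i, $x_3,x_4$ belong to the same half-space and $x_1,x_3$ are the end points of $L_{\min}$ ($\alpha_2=|x_1-x_3|$); in Type ii, $x_3,x_4$ belong to different half-spaces and $x_2,x_3$ are the end points of $L_{\min}$ ($\alpha_2=|x_2-x_3|$); in both types $x_1$ and $x_4$ belong to the same half-space ($\alpha_3=|x_1-x_4|$). Each $d$-simplex is congruent to a simplex in standard position. For $T$ in standard position, $h_T:=\mathrm{diam}(T)$ and $H_T:=\dfrac{\prod_{i=1}^d\alpha_i}{|T|}h_T$. *)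

(* Defs.v *)
From HB Require Import structures.
From mathcomp Require Import all_boot all_order all_fingroup all_algebra.
From mathcomp Require Import all_classical all_reals all_analysis.

Set Implicit Arguments.
Unset Strict Implicit.
Unset Printing Implicit Defensive.

Import Order.TTheory GRing.Theory Num.Theory.
Import numFieldNormedType.Exports.

Local Open Scope classical_set_scope.
Local Open Scope ring_scope.

(* The library norm on ['rV[R]_d] is the sup norm, hence the explicit Euclidean
   norm; the topologies agree, so the library [open], [closure], [interior]
   and [connected] are used below. *)
Definition dot (R : realType) (d : nat) (u v : 'rV[R]_d) : R :=
  \sum_(i < d) u 0 i * v 0 i.

Definition enorm (R : realType) (d : nat) (u : 'rV[R]_d) : R :=
  Num.sqrt (dot u u).

Definition edist (R : realType) (d : nat) (u v : 'rV[R]_d) : R := enorm (u - v).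

Definition diam (R : realType) (d : nat) (A : set 'rV[R]_d) : R :=
  sup [set r | exists x y, [/\ A x, A y & r = edist x y]].

Definition boundary (R : realType) (d : nat) (A : set 'rV[R]_d) : set 'rV[R]_d :=
  closure A `\` interior A.

(* A finite list of m points of R^d is the matrix ['M[R]_(m, d)] of its rows;
   the simplex with these vertices is their convex hull. *)
Definition hull (R : realType) (m d : nat) (X : 'M[R]_(m, d)) : set 'rV[R]_d :=
  [set p | exists w : 'rV[R]_m,
     [/\ forall i, 0 <= w 0 i, \sum_i w 0 i = 1 & p = w *m X]].

Definition affinely_independent (R : realType) (m d : nat) (X : 'M[R]_(m, d)) :=
  forall w : 'rV[R]_m, \sum_i w 0 i = 0 -> w *m X = 0 -> w = 0.

Definition face (R : realType) (d : nat) (k : 'I_d.+1) (T : 'M[R]_(d.+1, d)) :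
    set 'rV[R]_d :=
  hull (row' k T).

(* Polyhedral: the boundary is a finite union of nondegenerate
   (d-1)-simplices. *)
Record bounded_polyhedral_domain (R : realType) (d : nat)
    (Omega : set 'rV[R]_d) : Prop := BoundedPolyhedralDomain {
  domain_nonempty : Omega !=set0;
  domain_open : open Omega;
  domain_connected : connected Omega;
  domain_bounded : exists M : R, forall x, Omega x -> enorm x <= M;
  domain_polyhedral : exists Fs : seq 'M[R]_(d, d),
    (forall F, F \in Fs -> affinely_independent F) /\
    boundary Omega = \bigcup_(F in [set` Fs]) hull F }.

(* Since distinct members of a mesh have disjoint interiors, a mesh contains at
   most one vertex ordering of each of its simplices. *)
Record simplicial_mesh (R : realType) (d : nat) (Omega : set 'rV[R]_d)
    (Th : set 'M[R]_(d.+1, d)) : Prop := SimplicialMesh {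
  mesh_finite : finite_set Th;
  mesh_nondegenerate : forall T, Th T -> affinely_independent T;
  mesh_cover : closure Omega = \bigcup_(T in Th) hull T;
  mesh_disjoint : forall T T', Th T -> Th T' -> T <> T' ->
    interior (hull T) `&` interior (hull T') = set0;
  mesh_conforming : forall T k, Th T ->
    face k T `<=` boundary Omega \/
    exists T' k', [/\ Th T', T' <> T & face k T = face k' T'] }.

Definition edge (n : nat) : set ('I_n * 'I_n) := 
  [set e : 'I_n * 'I_n | (e.1 < e.2)%N].

Definition edge_length (R : realType) (d : nat) (T : 'M[R]_(d.+1, d))
    (e : 'I_d.+1 * 'I_d.+1) : R :=
  edist (row e.1 T) (row e.2 T).

Definition edge_adjacent (n : nat) (e f : 'I_n * 'I_n) : Prop :=
  e <> f /\ [|| e.1 == f.1, e.1 == f.2, e.2 == f.1 | e.2 == f.2].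

Definition shortest_edge (R : realType) (d : nat) (T : 'M[R]_(d.+1, d)) e :=
  edge e /\ forall f, edge f -> edge_length T e <= edge_length T f.

Definition longest_edge (R : realType) (d : nat) (T : 'M[R]_(d.+1, d)) e :=
  edge e /\ forall f, edge f -> edge_length T f <= edge_length T e.

(* [f] is a longest edge among those sharing exactly one end point with [e]. *)
Definition longest_adjacent_edge (R : realType) (d : nat)
    (T : 'M[R]_(d.+1, d)) (e f : 'I_d.+1 * 'I_d.+1) :=
  [/\ edge f, edge_adjacent e f &
    forall g, edge g -> edge_adjacent e g ->
      edge_length T g <= edge_length T f].

(* Lebesgue measure on R^2 and R^3 is the product measure transported along the
   coordinate bijections. *)
Definition vec2 (R : realType) (p : measurableTypeR R * measurableTypeR R) :
    'rV[R]_2 :=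
  \row_(i < 2) nth 0 [:: p.1 : R; p.2 : R] i.

Definition vec3 (R : realType)
    (p : measurableTypeR R * measurableTypeR R * measurableTypeR R) :
    'rV[R]_3 :=
  \row_(i < 3) nth 0 [:: p.1.1 : R; p.1.2 : R; p.2 : R] i.

Definition area (R : realType) (T : 'M[R]_(3, 2)) : R :=
  fine ((lebesgue_measure \x lebesgue_measure)%E (@vec2 R @^-1` hull T)).

Definition volume (R : realType) (T : 'M[R]_(4, 3)) : R :=
  fine (((lebesgue_measure \x lebesgue_measure) \x lebesgue_measure)%E
          (@vec3 R @^-1` hull T)).

(* The infima below are over finite nonempty sets, i.e. they are minima. *)
Definition H2 (R : realType) (T : 'M[R]_(3, 2)) : R :=
  diam (hull T) ^+ 2 / area T * inf [set edge_length T e | e in @edge 3].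

Definition H3 (R : realType) (T : 'M[R]_(4, 3)) : R :=
  diam (hull T) ^+ 2 / volume T *
  inf [set r | exists e f, [/\ edge e, edge f, e <> f &
                               r = edge_length T e * edge_length T f]].

Definition matrix_of_rows (R : realType) (m n : nat) (s : seq (seq R)) :
    'M[R]_(m, n) :=
  \matrix_(i < m, j < n) nth 0 (nth [::] s i) j.

(* The vertices x_1, x_2, ... are the rows 0, 1, ... *)
Definition standard_position2 (R : realType) (a1 a2 : R) (T : 'M[R]_(3, 2)) :
    Prop :=
  [/\ 0 < a1, 0 < a2 &
  exists s t : R,
   [/\ s ^+ 2 + t ^+ 2 = 1, 0 < t,
       T = matrix_of_rows 3 2 [:: [:: 0; 0]; [:: a1; 0]; [:: a2 * s; a2 * t]],
       longest_edge T (inord 1, inord 2) & a2 <= a1]].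

(* The closed half-space containing [a] and bounded by the perpendicular
   bisector hyperplane of the segment [a, b]. *)
Definition half_space (R : realType) (d : nat) (a b : 'rV[R]_d) :
    set 'rV[R]_d :=
  [set p | 0 <= dot (p - 2^-1 *: (a + b)) (a - b)].

Definition same_half_space (R : realType) (d : nat) (a b p q : 'rV[R]_d) :=
  half_space a b p /\ half_space a b q \/ half_space b a p /\ half_space b a q.

Definition different_half_spaces (R : realType) (d : nat) (a b p q : 'rV[R]_d) :=
  half_space a b p /\ half_space b a q \/ half_space b a p /\ half_space a b q.

Definition standard_position3 (R : realType) (a1 a2 a3 : R) (T : 'M[R]_(4, 3)) :
    Prop :=
  let x1 := row (inord 0) T in
  let x2 := row (inord 1) T in
  let x3 := row (inord 2) T in
  let x4 := row (inord 3) T in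
  [/\ 0 < a1, 0 < a2, 0 < a3 &
  exists s1 t1 s21 s22 t2 : R,
   [/\ [/\ s1 ^+ 2 + t1 ^+ 2 = 1, 0 < s1, 0 < t1 & a2 * s1 <= a1 / 2],
       [/\ s21 ^+ 2 + s22 ^+ 2 + t2 ^+ 2 = 1, 0 < t2 & a3 * s21 <= a1 / 2],
       same_half_space x1 x2 x1 x4 &
       [/\ T = matrix_of_rows 4 3
                 [:: [:: 0; 0; 0]; [:: a1; 0; 0]; [:: a2 * s1; a2 * t1; 0];
                     [:: a3 * s21; a3 * s22; a3 * t2]],
           shortest_edge T (inord 0, inord 2),
           longest_adjacent_edge T (inord 0, inord 2) (inord 0, inord 1) &
           same_half_space x1 x2 x3 x4]
       \/
       [/\ T = matrix_of_rows 4 3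
                 [:: [:: 0; 0; 0]; [:: a1; 0; 0]; [:: a1 - a2 * s1; a2 * t1; 0];
                     [:: a3 * s21; a3 * s22; a3 * t2]],
           shortest_edge T (inord 1, inord 2),
           longest_adjacent_edge T (inord 1, inord 2) (inord 0, inord 1) &
           different_half_spaces x1 x2 x3 x4]]].

(* The image of [T0] under a Euclidean isometry x |-> x Q + b is [T], up to a
   relabelling of the vertices; det Q = -1 accounts for mirror imaging. *)
Definition congruent (R : realType) (d : nat) (T0 T : 'M[R]_(d.+1, d)) : Prop :=
  exists (Q : 'M[R]_d) (b : 'rV[R]_d) (s : 'S_d.+1),
    Q *m Q^T = 1%:M /\ forall i, row (s i) T = row i T0 *m Q + b.

Definition standard_H2 (R : realType) (a1 a2 : R) (T : 'M[R]_(3, 2)) : R :=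
  a1 * a2 / area T * diam (hull T).

Definition standard_H3 (R : realType) (a1 a2 a3 : R) (T : 'M[R]_(4, 3)) : R :=
  a1 * a2 * a3 / volume T * diam (hull T).

(* The radius of the circle through the three vertices, which exists and is
   unique when these are not collinear. *)
Definition circumradius (R : realType) (T : 'M[R]_(3, 2)) : R :=
  xget 0 [set r | exists c : 'rV[R]_2, forall i, edist (row i T) c = r].

(* [ordS] is the cyclic successor: the other two vertices are ordS i and
   ordS (ordS i). *)
Definition interior_angle (R : realType) (T : 'M[R]_(3, 2)) (i : 'I_3) : R :=
  let u := row (ordS i) T - row i T in
  let v := row (ordS (ordS i)) T - row i T in
  acos (dot u v / (enorm u * enorm v)).

Definition maximum_angle (R : realType) (T : 'M[R]_(3, 2)) : R :=
  \big[Num.max/0]_(i < 3) interior_angle T i.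

Definition H_over_h_bounded (R : realType) (I : Type)
    (Th : I -> set 'M[R]_(3, 2)) : Prop :=
  exists C : R, forall i T0, Th i T0 -> H2 T0 / diam (hull T0) <= C.

Definition semiregular (R : realType) (I : Type)
    (Th : I -> set 'M[R]_(3, 2)) : Prop :=
  exists C : R, 0 < C /\
    forall i T0, Th i T0 -> circumradius T0 <= C * diam (hull T0).

Definition maximum_angle_condition (R : realType) (I : Type)
    (Th : I -> set 'M[R]_(3, 2)) : Prop :=
  exists delta : R, [/\ 0 < delta, delta < pi &
    forall i T0, Th i T0 -> maximum_angle T0 <= delta].

(* Main.v *)
Require Import Defs.
From HB Require Import structures.
From mathcomp Require Import all_boot all_order all_fingroup all_algebra.
From mathcomp Require Import all_classical all_reals all_analysis.
From mathcomp Require Import measurable_realfun ring lra.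
Import Order.TTheory GRing.Theory Num.Theory.
Import numFieldNormedType.Exports.
(* [edist] is also the name of an extended distance on metric spaces; from here
   on it is the Euclidean one. *)
Import Defs.
Local Open Scope classical_set_scope.
Local Open Scope ring_scope.

Set Implicit Arguments.
Unset Strict Implicit.
Unset Printing Implicit Defensive.

(** All the quantities compared are functions of the edge lengths and of the
    measure of the simplex, and each claim is an elementary inequality between
    edge lengths once the measure is under control.

    The measure. The barycentric coordinates realise a nondegenerate simplex
    with edge matrix M as the preimage, under an affine map with linear part
    M^-1, of one fixed reference simplex. Taking preimages under an affine map
    with linear part A divides Lebesgue measure by the absolute value of det A
    ([measure_affine2], [measure_affine3]: the map is factored into maps that
    move only the last coordinate, or only the other ones, and Fubini reduces
    each factor to a lower dimension), so the measure of the simplex is a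
    universal constant times the absolute value of det M ([areaE], [volumeE]).
    A congruence multiplies M by an orthogonal matrix and permutes the
    vertices, so it preserves the measure; it also preserves the set of edge
    lengths, and the diameter, which is the largest edge length
    ([edist_hull_le]). Hence H is invariant under congruence ([congruent_H2],
    [congruent_H3]), and T_0 may be replaced by its standard position T.

    Standard positions. For d = 2, alpha_2 is the shortest edge and the
    triangle inequality gives alpha_1 <= h <= 2 alpha_1. For d = 3, alpha_2 is
    the shortest edge, alpha_1 <= h <= 2 alpha_1 because the only edge disjoint
    from the shortest one is at most the sum of two edges that meet the latter,
    and alpha_3 is at most twice any edge other than the shortest one; so
    alpha_2 alpha_3 is comparable to the smallest product of two distinct
    edges.

    Circumradius. With edges a, b, c one has 2 R |det M| = a b c
    ([circumradius_edges]), while H is proportional to h^2 min(a, b, c) divided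
    by |det M|; the second longest edge lies between h/2 and h, which compares
    the two. Since R = h / (2 sin theta) for the angle theta opposite to the
    longest edge, R <= C h bounds sin theta from below. This is a bound on the
    maximum angle away from pi, because every angle that is not opposite to a
    longest edge is acute ([semiregular_angle]); conversely the angle opposite
    to a longest edge has cosine at most 1/2, so bounding it away from pi also
    bounds its sine away from 0 ([angle_semiregular]). *)

(** * Lebesgue measure under affine maps *)

Lemma measurable_affine (R : realType) (c t : R) :
  measurable_fun setT (fun y : measurableTypeR R => c * y + t : measurableTypeR R).
Proof. by apply: measurable_funD => //; exact: measurable_funM. Qed.

(** A measure on the line is determined by its values on half-open intervals,
    and an affine map takes an interval to an interval whose length is
    multiplied by the absolute value of c; a negative c exchanges the open and
    the closed end, which does not change the length. *)
Lemma lebesgue_measure_affine (R : realType) (c t : R)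
    (A : set (measurableTypeR R)) : c != 0 -> measurable A ->
  lebesgue_measure ((fun y => c * y + t) @^-1` A)
    = (`|c|^-1%:E * lebesgue_measure A)%E.
Proof.
move=> c0 mA.
pose f (y : measurableTypeR R) : measurableTypeR R := c * y + t.
have mf : measurable_fun setT f by exact: measurable_affine.
have nc : 0 < `|c| by rewrite normr_gt0.
pose nu : {measure set _ -> \bar R} :=
  measure_function_pushforward__canonical__measure_function_Measure lebesgue_measure mf.
suff -> : lebesgue_measure A = mscale (NngNum (normr_ge0 c)) nu A.
  by rewrite /mscale /= muleA -EFinM mulVf ?mul1e// gt_eqF.
apply: lebesgue_measure_unique => // _ [[a b]] _ <- /=.
rewrite /mscale /= /nu /= /pushforward.
have [c_lt0|c_gt0|/eqP] := ltrgtP c 0; last by rewrite (negbTE c0).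
- have -> : f @^-1` [set` `]a, b]] = [set` `[(b - t) / c, (a - t) / c[].
    apply/funext => y /=; rewrite /f !in_itv /= andbC; apply/propext.
    by rewrite ler_ndivrMr// ltr_ndivlMr// lerBrDr ltrBlDr [y * c]mulrC.
  rewrite !lebesgue_measure_itv/= !lte_fin ltr_nM2r ?invr_lt0// ltrD2r.
  case: ifP => _; last by rewrite mule0.
  by rewrite -!EFinB -EFinM ltr0_norm//; congr EFin; field.
- have -> : f @^-1` [set` `]a, b]] = [set` `](a - t) / c, (b - t) / c]].
    apply/funext => y /=; rewrite /f !in_itv /=; apply/propext.
    by rewrite ltr_pdivrMr// ler_pdivlMr// lerBrDr ltrBlDr [y * c]mulrC.
  rewrite !lebesgue_measure_itv/= !lte_fin ltr_pM2r ?invr_gt0// ltrD2r.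
  case: ifP => _; last by rewrite mule0.
  by rewrite -!EFinB -EFinM gtr0_norm//; congr EFin; field.
Qed.

Section Fibrewise.
Local Open Scope ereal_scope.
Context d1 d2 (T1 : measurableType d1) (T2 : measurableType d2) (R : realType).
Variables (m1 : {sigma_finite_measure set T1 -> \bar R})
          (m2 : {sigma_finite_measure set T2 -> \bar R}).

(** A map that moves only the second coordinate acts on each section over the
    first one separately, so a scaling factor common to all sections passes
    through the integral. *)
Lemma product_measure_preimage_snd (k : T1 -> T2 -> T2) (C : R) (S : set (T1 * T2)) :
  (0 <= C)%R ->
  (forall x A, measurable A -> m2 (k x @^-1` A) = C%:E * m2 A) ->
  measurable S ->
  (m1 \x m2) ((fun p => (p.1, k p.1 p.2)) @^-1` S) = C%:E * (m1 \x m2) S.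
Proof.
move=> C0 kE mS; rewrite /product_measure1 -ge0_integralZl//.
- apply: eq_integral => x _ /=; rewrite -(kE x); last exact: measurable_xsection.
  by congr (m2 _); apply/seteqP; split => y; rewrite /xsection/= !inE.
- exact: measurable_fun_xsection.
Qed.

Lemma product_measure2_eq (S : set (T1 * T2)) : measurable S ->
  (m1 \x m2) S = \int[m2]_y m1 (ysection S y).
Proof.
move=> mS; rewrite -[RHS]/((m1 \x^ m2) S).
by apply: product_measure_unique => // A B mA mB; exact: product_measure2E.
Qed.

(** Exchanging the order of integration reduces this to sections over the second
    coordinate; the preimage has to be measurable for its sections to be
    integrable in that order. *)
Lemma product_measure_preimage_fst (k : T2 -> T1 -> T1) (C : R) (S : set (T1 * T2)) :
  (0 <= C)%R ->
  measurable_fun setT (fun p : T1 * T2 => (k p.2 p.1, p.2)) ->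
  (forall y A, measurable A -> m1 (k y @^-1` A) = C%:E * m1 A) ->
  measurable S ->
  (m1 \x m2) ((fun p => (k p.2 p.1, p.2)) @^-1` S) = C%:E * (m1 \x m2) S.
Proof.
move=> C0 mk kE mS.
have mpre : measurable ((fun p => (k p.2 p.1, p.2)) @^-1` S).
  by rewrite -[X in measurable X]setTI; exact: mk.
rewrite !product_measure2_eq// -ge0_integralZl//.
- apply: eq_integral => y _ /=; rewrite -(kE y); last exact: measurable_ysection.
  by congr (m1 _); apply/seteqP; split => x; rewrite /ysection/= !inE.
- exact: measurable_fun_ysection.
Qed.
End Fibrewise.

Notation line R := (measurableTypeR R).
Notation plane R := (line R * line R)%type.
Notation solid R := (plane R * line R)%type.
Notation mu1 := lebesgue_measure.
Notation mu2 := (mu1 \x mu1)%E.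
Notation mu3 := (mu2 \x mu1)%E.

(** Lebesgue measure of the plane as a sigma-finite measure, so that it can in
    turn be a factor of a product measure. *)
Definition plane_measure (R : realType) : set (plane R) -> \bar R := mu2.

HB.instance Definition _ (R : realType) := Measure.on (@plane_measure R).

Lemma plane_measure_sigma_finite (R : realType) :
  sigma_finite setT (@plane_measure R).
Proof.
pose I (n : nat) : set (line R) := [set` `[- n%:R, n%:R]].
exists (fun n => I n `*` I n).
  apply/esym/seteqP; split => // -[x y] _.
  exists (Num.bound (`|x| + `|y|)) => //=; rewrite /I /= !in_itv /= -!ler_norml.
  have := archi_boundP (addr_ge0 (normr_ge0 x) (normr_ge0 y)).
  have := normr_ge0 x; have := normr_ge0 y.
  by set N := (Num.bound _)%:R; split; lra.
move=> n; have mI : measurable (I n) by exact: measurable_itv.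
split; first exact: measurableX.
rewrite /plane_measure product_measure1E//.
have : (lebesgue_measure (I n) < +oo)%E.
  by rewrite /I lebesgue_measure_itv; case: ifP => // _; rewrite -EFinB ltry.
by move=> Ioo; rewrite lte_mul_pinfty// ge0_fin_numE.
Qed.

HB.instance Definition _ (R : realType) :=
  Measure_isSigmaFinite.Build _ _ _ (@plane_measure R)
    (@plane_measure_sigma_finite R).

Definition affine2 (R : realType) (a b c d e f : R) (p : plane R) : plane R :=
  (a * p.1 + b * p.2 + e, c * p.1 + d * p.2 + f).

Definition affine3 (R : realType) (a11 a12 a13 a21 a22 a23 a31 a32 a33 : R)
    (b1 b2 b3 : R) (p : solid R) : solid R :=
  ((a11 * p.1.1 + a12 * p.1.2 + a13 * p.2 + b1,
    a21 * p.1.1 + a22 * p.1.2 + a23 * p.2 + b2),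
   a31 * p.1.1 + a32 * p.1.2 + a33 * p.2 + b3).

Lemma measurable_coord2 (R : realType) (a b c : R) :
  measurable_fun setT (fun p : plane R => a * p.1 + b * p.2 + c : line R).
Proof.
by do ?apply: measurable_funD => //; apply: measurable_funM => //;
  exact: measurable_fst || exact: measurable_snd.
Qed.

Lemma measurable_affine2 (R : realType) (a b c d e f : R) :
  measurable_fun setT (affine2 a b c d e f).
Proof. by apply: measurable_fun_pair; exact: measurable_coord2. Qed.

Lemma measurable_coord3 (R : realType) (a b c d : R) :
  measurable_fun setT
    (fun p : solid R => a * p.1.1 + b * p.1.2 + c * p.2 + d : line R).
Proof.
do ?apply: measurable_funD => //; apply: measurable_funM => //.
- exact: (measurableT_comp measurable_fst measurable_fst).
- exact: (measurableT_comp measurable_snd measurable_fst).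
Qed.

Lemma measurable_affine3 (R : realType) (a11 a12 a13 a21 a22 a23 a31 a32 a33 : R)
    (b1 b2 b3 : R) :
  measurable_fun setT (affine3 a11 a12 a13 a21 a22 a23 a31 a32 a33 b1 b2 b3).
Proof.
by do ?apply: measurable_fun_pair; exact: measurable_coord3.
Qed.

Lemma measurable_preimage d1 d2 (T1 : measurableType d1) (T2 : measurableType d2)
    (f : T1 -> T2) (S : set T2) :
  measurable_fun setT f -> measurable S -> measurable (f @^-1` S).
Proof. by move=> mf mS; rewrite -[X in measurable X]setTI; exact: mf. Qed.

(** Gaussian elimination: with pivot a, the map is a change of the first
    coordinate by the factor a, followed by a change of the second one by the
    factor r = (a d - b c) / a. *)
Lemma measure_affine2_pivot (R : realType) (a b c d e f : R) (S : set (plane R)) :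
  a != 0 -> a * d - b * c != 0 -> measurable S ->
  mu2 (affine2 a b c d e f @^-1` S) = (`|a * d - b * c|^-1%:E * mu2 S)%E.
Proof.
move=> a0 D0 mS.
pose r := d - c / a * b.
have Dr : a * d - b * c = a * r by rewrite /r; field.
have r0 : r != 0 by move: D0; rewrite Dr mulf_eq0 negb_or => /andP[].
pose h (x y : line R) : line R := r * y + (c / a * x + (f - c / a * e)).
pose k (y x : line R) : line R := a * x + (b * y + e).
pose A (p : plane R) : plane R := (p.1, h p.1 p.2).
pose B (p : plane R) : plane R := (k p.2 p.1, p.2).
have -> : affine2 a b c d e f @^-1` S = B @^-1` (A @^-1` S).
  rewrite -comp_preimage; congr (_ @^-1` S); apply/funext => -[x y] /=.
  rewrite /affine2 /A /B /= /h /k; congr (_, _); first by rewrite addrA.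
  by rewrite /r; field.
rewrite (product_measure_preimage_fst _ (k := k) (C := `|a|^-1)).
- rewrite (product_measure_preimage_snd _ (k := h) (C := `|r|^-1)) //.
  + by rewrite muleA -EFinM Dr normrM invfM.
  + by move=> x X mX; exact: lebesgue_measure_affine.
- by rewrite invr_ge0.
- have -> : (fun p : plane R => (k p.2 p.1, p.2)) = affine2 a b 0 1 e 0.
    by apply/funext => -[x y]; rewrite /affine2/k/= addrA mul0r add0r mul1r addr0.
  exact: measurable_affine2.
- by move=> y X mX; exact: lebesgue_measure_affine.
- have -> : A = affine2 1 0 (c / a) r 0 (f - c / a * e).
    by apply/funext => -[x y]; rewrite /affine2 /A /h/=; congr (_, _); ring.
  apply: measurable_preimage mS; exact: measurable_affine2.
Qed.

(** If a = 0, then c is not 0, and the composite with the measure-preserving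
    shear (x, y) |-> (x + y, y) has pivot c. *)
Lemma measure_affine2 (R : realType) (a b c d e f : R) (S : set (plane R)) :
  a * d - b * c != 0 -> measurable S ->
  mu2 (affine2 a b c d e f @^-1` S) = (`|a * d - b * c|^-1%:E * mu2 S)%E.
Proof.
move=> D0 mS; have [a0|a0] := eqVneq a 0; last exact: measure_affine2_pivot.
have c0 : c != 0 by apply: contra_neq D0 => ->; rewrite a0; ring.
pose S' := affine2 1 (-1) 0 1 0 0 @^-1` S.
have mS' : measurable S' by apply: measurable_preimage mS; exact: measurable_affine2.
have -> : affine2 a b c d e f @^-1` S
    = affine2 (a + c) (b + d) c d (e + f) f @^-1` S'.
  rewrite -comp_preimage; congr (_ @^-1` S); apply/funext => -[x y] /=.
  by rewrite /affine2 /=; congr (_, _); ring.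
have Dc : (a + c) * d - (b + d) * c = a * d - b * c by ring.
rewrite measure_affine2_pivot// ?Dc// ?a0 ?add0r//.
rewrite measure_affine2_pivot//.
by rewrite mulr0 subr0 mulr1 normr1 invr1 mul1e.
Qed.

(** Elimination by blocks: when the leading 2 x 2 minor m is not 0, the map is
    an affine change of the first two coordinates (with a translation that
    depends on the third one), followed by a change of the third coordinate by
    the factor D / m. *)
Lemma measure_affine3_pivot (R : realType)
    (a11 a12 a13 a21 a22 a23 a31 a32 a33 b1 b2 b3 : R) (S : set (solid R)) :
  let D := a11 * (a22 * a33 - a23 * a32) - a12 * (a21 * a33 - a23 * a31)
           + a13 * (a21 * a32 - a22 * a31) in
  a11 * a22 - a12 * a21 != 0 -> D != 0 -> measurable S ->
  mu3 (affine3 a11 a12 a13 a21 a22 a23 a31 a32 a33 b1 b2 b3 @^-1` S)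
    = (`|D|^-1%:E * mu3 S)%E.
Proof.
move=> D m0 D0 mS; set m := (X in X != 0) in m0.
(* (u, v) solves (u, v) A = (a31, a32) for the leading block A, and r is the
   Schur complement of A. *)
pose u := (a31 * a22 - a32 * a21) / m.
pose v := (a32 * a11 - a31 * a12) / m.
pose r := a33 - u * a13 - v * a23.
pose w := b3 - u * b1 - v * b2.
have Dr : D = m * r by rewrite /D /r /u /v /m; field.
have r0 : r != 0 by move: D0; rewrite Dr mulf_eq0 negb_or => /andP[].
pose h (p : plane R) (z : line R) : line R := r * z + (u * p.1 + v * p.2 + w).
pose A (p : solid R) : solid R := (p.1, h p.1 p.2).
pose k (z : line R) := affine2 a11 a12 a21 a22 (a13 * z + b1) (a23 * z + b2).
pose B (p : solid R) : solid R := (k p.2 p.1, p.2).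
have -> : affine3 a11 a12 a13 a21 a22 a23 a31 a32 a33 b1 b2 b3 @^-1` S
    = B @^-1` (A @^-1` S).
  rewrite -comp_preimage; congr (_ @^-1` S); apply/funext => -[[x y] z] /=.
  rewrite /affine3 /A /B /h /k /affine2 /=; congr (_, _, _); rewrite ?addrA//.
  by rewrite /r /w /u /v /m; field.
rewrite -[mu3]/(@plane_measure R \x mu1)%E.
rewrite (product_measure_preimage_fst _ (k := k) (C := `|m|^-1)).
- rewrite (product_measure_preimage_snd _ (k := h) (C := `|r|^-1)) //.
  + by rewrite muleA -EFinM Dr normrM invfM.
  + by move=> x X mX; exact: lebesgue_measure_affine.
- by rewrite invr_ge0.
- have -> : (fun p : solid R => (k p.2 p.1, p.2))
      = affine3 a11 a12 a13 a21 a22 a23 0 0 1 b1 b2 0.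
    by apply/funext => -[[x y] z]; rewrite /affine3 /k /affine2/=; congr (_, _, _); ring.
  exact: measurable_affine3.
- by move=> z X mX; exact: measure_affine2.
- have -> : A = affine3 1 0 0 0 1 0 u v r 0 0 w.
    by apply/funext => -[[x y] z]; rewrite /affine3 /A /h/=;
      congr (_, _); [congr (_, _)|]; ring.
  apply: measurable_preimage mS; exact: measurable_affine3.
Qed.

(** If the leading minor vanishes, add v times the third coordinate of the image
    to the first two. This is a shear, and changes the leading minor by a
    combination of the two other minors of the first two columns; these cannot
    both vanish as well, so v = (1, 0) or v = (0, 1) makes it nonzero. *)
Lemma measure_affine3 (R : realType)
    (a11 a12 a13 a21 a22 a23 a31 a32 a33 b1 b2 b3 : R) (S : set (solid R)) :
  let D := a11 * (a22 * a33 - a23 * a32) - a12 * (a21 * a33 - a23 * a31)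
           + a13 * (a21 * a32 - a22 * a31) in
  D != 0 -> measurable S ->
  mu3 (affine3 a11 a12 a13 a21 a22 a23 a31 a32 a33 b1 b2 b3 @^-1` S)
    = (`|D|^-1%:E * mu3 S)%E.
Proof.
move=> D D0 mS.
have [m0|] := eqVneq (a11 * a22 - a12 * a21) 0; last first.
  by move=> m0; exact: measure_affine3_pivot.
have sheared (v1 v2 : R) :
    (a11 + v1 * a31) * (a22 + v2 * a32) - (a12 + v1 * a32) * (a21 + v2 * a31) != 0 ->
  mu3 (affine3 a11 a12 a13 a21 a22 a23 a31 a32 a33 b1 b2 b3 @^-1` S)
    = (`|D|^-1%:E * mu3 S)%E.
  move=> v0.
  pose S' := affine3 1 0 (- v1) 0 1 (- v2) 0 0 1 0 0 0 @^-1` S.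
  have mS' : measurable S' by apply: measurable_preimage mS; exact: measurable_affine3.
  have -> : affine3 a11 a12 a13 a21 a22 a23 a31 a32 a33 b1 b2 b3 @^-1` S
    = affine3 (a11 + v1 * a31) (a12 + v1 * a32) (a13 + v1 * a33)
              (a21 + v2 * a31) (a22 + v2 * a32) (a23 + v2 * a33)
              a31 a32 a33 (b1 + v1 * b3) (b2 + v2 * b3) b3 @^-1` S'.
    rewrite -comp_preimage; congr (_ @^-1` S); apply/funext => -[[x y] z] /=.
    by rewrite /affine3 /=; congr (_, _); [congr (_, _)|]; ring.
  have DS : D = (a11 + v1 * a31) * ((a22 + v2 * a32) * a33 - (a23 + v2 * a33) * a32)
              - (a12 + v1 * a32) * ((a21 + v2 * a31) * a33 - (a23 + v2 * a33) * a31)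
              + (a13 + v1 * a33) * ((a21 + v2 * a31) * a32 - (a22 + v2 * a32) * a31).
    by rewrite /D; ring.
  rewrite measure_affine3_pivot -?DS// measure_affine3_pivot//.
  - have -> : (1 * (1 * 1 - - v2 * 0) - 0 * (0 * 1 - - v2 * 0)
               + - v1 * (0 * 0 - 1 * 0) : R) = 1 by ring.
    by rewrite normr1 invr1 mul1e.
  - by rewrite !(mulr0, subr0, mulr1, mul0r, addr0) oner_neq0.
have [m1|m1] := eqVneq (a31 * a22 - a32 * a21) 0.
  have [m2|m2] := eqVneq (a11 * a32 - a12 * a31) 0.
    have De : D = a13 * (- (a31 * a22 - a32 * a21)) - a23 * (a11 * a32 - a12 * a31)
              + a33 * (a11 * a22 - a12 * a21) by rewrite /D; ring.
    by move: D0; rewrite De m0 m1 m2 oppr0 !mulr0 subr0 addr0 eqxx.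
  apply: (sheared 0 1).
  have -> : (a11 + 0 * a31) * (a22 + 1 * a32) - (a12 + 0 * a32) * (a21 + 1 * a31)
    = (a11 * a22 - a12 * a21) + (a11 * a32 - a12 * a31) by ring.
  by rewrite m0 add0r.
apply: (sheared 1 0).
have -> : (a11 + 1 * a31) * (a22 + 0 * a32) - (a12 + 1 * a32) * (a21 + 0 * a31)
  = (a11 * a22 - a12 * a21) + (a31 * a22 - a32 * a21) by ring.
by rewrite m0 add0r.
Qed.

(** * Simplices as affine images of a reference simplex *)

Lemma det_mx2 (R : comNzRingType) (A : 'M[R]_2) :
  \det A = A 0 0 * A 1 1 - A 0 1 * A 1 0.
Proof.
rewrite (expand_det_row _ 0) !big_ord_recl big_ord0 addr0 /cofactor !det_mx11 !mxE /=.
have e1 : lift (0 : 'I_2) (0 : 'I_1) = 1 by apply/val_inj.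
have e2 : lift (1 : 'I_2) (0 : 'I_1) = 0 by apply/val_inj.
by rewrite !(e1, e2) /bump /=; ring.
Qed.

Lemma det_mx3 (R : comNzRingType) (A : 'M[R]_3) :
  \det A = A 0 0 * (A 1 1 * A 2%:R 2%:R - A 1 2%:R * A 2%:R 1)
         - A 0 1 * (A 1 0 * A 2%:R 2%:R - A 1 2%:R * A 2%:R 0)
         + A 0 2%:R * (A 1 0 * A 2%:R 1 - A 1 1 * A 2%:R 0).
Proof.
rewrite (expand_det_row _ 0) !big_ord_recl big_ord0 addr0 /cofactor !det_mx2 !mxE /=.
have e01 : lift (0 : 'I_3) (0 : 'I_2) = 1 by apply/val_inj.
have e02 : lift (0 : 'I_3) (1 : 'I_2) = 2%:R by apply/val_inj.
have e0 : lift (0 : 'I_3) (lift (0 : 'I_2) (0 : 'I_1)) = 2%:R by apply/val_inj.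
have e10 : lift (1 : 'I_3) (0 : 'I_2) = 0 by apply/val_inj.
have e11 : lift (1 : 'I_3) (1 : 'I_2) = 2%:R by apply/val_inj.
have e20 : lift (2%:R : 'I_3) (0 : 'I_2) = 0 by apply/val_inj.
have e21 : lift (2%:R : 'I_3) (1 : 'I_2) = 1 by apply/val_inj.
by rewrite !(e0, e01, e02, e10, e11, e20, e21) /bump /=; ring.
Qed.

Section Simplex.
Variables (R : realType) (d : nat).
Implicit Types T : 'M[R]_(d.+1, d).

Definition edge_mx T : 'M[R]_d :=
  \matrix_(i, j) (T (lift ord0 i) j - T ord0 j).

Lemma row_edge_mx T i : row i (edge_mx T) = row (lift ord0 i) T - row ord0 T.
Proof. by apply/rowP => j; rewrite !mxE. Qed.

Lemma mulmx_edge_mx (v : 'rV_d) T :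
  v *m edge_mx T
    = \sum_i v 0 i *: row (lift ord0 i) T - (\sum_i v 0 i) *: row ord0 T.
Proof.
rewrite mulmx_sum_row; under eq_bigr do rewrite row_edge_mx scalerBr.
by rewrite sumrB -scaler_suml.
Qed.

(** The weight of the vertex 0 is eliminated by the condition that the weights
    sum to 1. *)
Lemma hull_edge_mx T p : hull T p <->
  exists v : 'rV_d, [/\ forall i, 0 <= v 0 i, \sum_i v 0 i <= 1 &
    p - row ord0 T = v *m edge_mx T].
Proof.
split=> [[w [w0 w1 ->]]|[v [v0 v1 pE]]].
- exists (\row_i w 0 (lift ord0 i)); split.
  + by move=> i; rewrite mxE.
  + under eq_bigr do rewrite mxE.
    by rewrite -w1 big_ord_recl lerDr.
  + rewrite mulmx_edge_mx mulmx_sum_row big_ord_recl.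
    under [X in _ = X - _]eq_bigr do rewrite mxE.
    under [X in _ = _ - X *: _]eq_bigr do rewrite mxE.
    have -> : w 0 ord0 = 1 - \sum_i w 0 (lift ord0 i) by rewrite -w1 big_ord_recl addrK.
    by apply/rowP => j; rewrite !mxE; ring.
- pose v' : 'rV_d.+1 := \row_i
    if unlift ord0 i is Some j then v 0 j else 1 - \sum_j v 0 j.
  have v'0 : v' 0 ord0 = 1 - \sum_j v 0 j by rewrite mxE unlift_none.
  have v'S j : v' 0 (lift ord0 j) = v 0 j by rewrite mxE liftK.
  exists v'; split.
  + by move=> i; rewrite mxE; case: unliftP => [j _|_] //; rewrite subr_ge0.
  + by rewrite big_ord_recl v'0 [X in _ + X](eq_bigr _ (fun j _ => v'S j)) subrK.
  + move/eqP: pE; rewrite subr_eq => /eqP ->.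
    rewrite mulmx_edge_mx mulmx_sum_row big_ord_recl v'0.
    rewrite [X in _ = _ + X](eq_bigr (fun j => v 0 j *: row (lift ord0 j) T)); last first.
      by move=> j _; rewrite v'S.
    by apply/rowP => j; rewrite !mxE; ring.
Qed.

Lemma hull_unitmx T p : edge_mx T \in unitmx ->
  let v := (p - row ord0 T) *m invmx (edge_mx T) in
  hull T p <-> (forall i, 0 <= v 0 i) /\ \sum_i v 0 i <= 1.
Proof.
move=> uT v; rewrite hull_edge_mx; split=> [[u [u0 u1 pE]]|[v0 v1]].
  by rewrite /v pE mulmxK.
by exists v; split=> //; rewrite /v mulmxKV.
Qed.

(** A row vector killed by the edge matrix extends, by minus the sum of its
    entries at the vertex 0, to weights of sum 0 killed by the vertices. *)
Lemma affinely_independent_unitmx T :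
  affinely_independent T -> edge_mx T \in unitmx.
Proof.
move=> aT; rewrite -row_free_unit; apply: inj_row_free => v vE.
pose w : 'rV_d.+1 := \row_i
  if unlift ord0 i is Some j then v 0 j else - \sum_j v 0 j.
have w0 : w 0 ord0 = - \sum_j v 0 j by rewrite mxE unlift_none.
have wS j : w 0 (lift ord0 j) = v 0 j by rewrite mxE liftK.
suff: w = 0 by move=> w_0; apply/rowP => j; rewrite -wS w_0 !mxE.
apply: aT.
  by rewrite big_ord_recl w0 [X in _ + X](eq_bigr _ (fun j _ => wS j)) addNr.
rewrite mulmx_sum_row big_ord_recl w0.
rewrite [X in _ + X](eq_bigr (fun j => v 0 j *: row (lift ord0 j) T)); last first.
  by move=> j _; rewrite wS.
by rewrite scaleNr addrC -mulmx_edge_mx.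
Qed.

Lemma hull_perm T T' (s : 'S_d.+1) :
  (forall i, row (s i) T = row i T') -> hull T = hull T'.
Proof.
move=> sE; have TE : T' = row_perm s T.
  by apply/row_matrixP => i; rewrite -sE; apply/rowP => j; rewrite !mxE.
apply/seteqP; split=> [p [w [w0 w1 ->]]|p [w [w0 w1 ->]]].
- exists (\row_i w 0 (s i)); split.
  + by move=> i; rewrite mxE.
  + by under eq_bigr do rewrite mxE; rewrite -w1 [RHS](reindex_inj (@perm_inj _ s)).
  + rewrite !mulmx_sum_row (reindex_inj (@perm_inj _ s)).
    by apply: eq_bigr => i _; rewrite mxE sE.
- exists (\row_i w 0 (s^-1 i)%g); split.
  + by move=> i; rewrite mxE.
  + under eq_bigr do rewrite mxE.
    by rewrite -w1 [RHS](reindex_inj (@perm_inj _ (s^-1)%g)).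
  + rewrite !mulmx_sum_row [RHS](reindex_inj (@perm_inj _ s)).
    by apply: eq_bigr => i _; rewrite mxE sE permK.
Qed.

Definition move_simplex (Q : 'M[R]_d) (b : 'rV[R]_d) T : 'M[R]_(d.+1, d) :=
  \matrix_i (row i T *m Q + b).

Lemma edge_mx_move Q b T : edge_mx (move_simplex Q b T) = edge_mx T *m Q.
Proof.
apply/row_matrixP => i; rewrite row_edge_mx row_mul row_edge_mx !rowK mulmxBl.
by rewrite opprD addrACA subrr addr0.
Qed.

Lemma norm_det_orthogonal (Q : 'M[R]_d) : Q *m Q^T = 1%:M -> `|\det Q| = 1.
Proof.
move=> QE; have : \det Q ^+ 2 == 1 by rewrite expr2 -{2}det_tr -det_mulmx QE det1.
by rewrite sqrf_eq1 => /orP[] /eqP ->; rewrite ?normrN normr1.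
Qed.

(** T' is the image of T0 under the isometry with the labelling of T0: its edge
    matrix is that of T0 times an orthogonal matrix, whereas relabelling the
    vertices only affects the edge matrix and not the hull. *)
Lemma congruent_hull T0 T : congruent T0 T -> exists T',
  [/\ hull T' = hull T, `|\det (edge_mx T')| = `|\det (edge_mx T0)|
    & (edge_mx T' \in unitmx) = (edge_mx T0 \in unitmx)].
Proof.
move=> [Q [b [s [QQ sE]]]]; exists (move_simplex Q b T0).
have dQ := norm_det_orthogonal QQ; rewrite edge_mx_move; split.
- by apply/esym/(@hull_perm _ _ s) => i; rewrite sE rowK.
- by rewrite det_mulmx normrM dQ mulr1.
- by rewrite unitmx_mul; have [-> _] := mulmx1_unit QQ; rewrite andbT.
Qed.

End Simplex.

Definition triangle (R : realType) : set (plane R) :=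
  [set p | [/\ 0 <= p.1, 0 <= p.2 & p.1 + p.2 <= 1]].

Definition tetrahedron (R : realType) : set (solid R) :=
  [set p | [/\ 0 <= p.1.1, 0 <= p.1.2, 0 <= p.2 & p.1.1 + p.1.2 + p.2 <= 1]].

Lemma measurable_triangle (R : realType) : measurable (@triangle R).
Proof.
have mh a b c : measurable [set p : plane R | 0 <= a * p.1 + b * p.2 + c].
  have -> : [set p : plane R | 0 <= a * p.1 + b * p.2 + c]
      = (fun p : plane R => a * p.1 + b * p.2 + c : line R) @^-1` [set` `[0, +oo[].
    by apply/funext => p /=; rewrite in_itv/= andbT.
  by apply: measurable_preimage; [exact: measurable_coord2|exact: measurable_itv].
have -> : @triangle R =
    [set p : plane R | 0 <= 1 * p.1 + 0 * p.2 + 0] `&`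
    ([set p : plane R | 0 <= 0 * p.1 + 1 * p.2 + 0] `&`
     [set p : plane R | 0 <= -1 * p.1 + -1 * p.2 + 1]).
  by apply/seteqP; split=> -[x y] /=;
    [move=> [/= ? ? ?]; do !split|move=> [? [? ?]]; split=> /=]; lra.
by do ?apply: measurableI.
Qed.

Lemma measurable_tetrahedron (R : realType) : measurable (@tetrahedron R).
Proof.
have mh a b c d : measurable [set p : solid R | 0 <= a * p.1.1 + b * p.1.2 + c * p.2 + d].
  have -> : [set p : solid R | 0 <= a * p.1.1 + b * p.1.2 + c * p.2 + d]
      = (fun p : solid R => a * p.1.1 + b * p.1.2 + c * p.2 + d : line R)
          @^-1` [set` `[0, +oo[].
    by apply/funext => p /=; rewrite in_itv/= andbT.
  by apply: measurable_preimage; [exact: measurable_coord3|exact: measurable_itv].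
have -> : @tetrahedron R =
    [set p : solid R | 0 <= 1 * p.1.1 + 0 * p.1.2 + 0 * p.2 + 0] `&`
    ([set p : solid R | 0 <= 0 * p.1.1 + 1 * p.1.2 + 0 * p.2 + 0] `&`
    ([set p : solid R | 0 <= 0 * p.1.1 + 0 * p.1.2 + 1 * p.2 + 0] `&`
     [set p : solid R | 0 <= -1 * p.1.1 + -1 * p.1.2 + -1 * p.2 + 1])).
  by apply/seteqP; split=> -[[x y] z] /=;
    [move=> [/= ? ? ? ?]; do !split|move=> [? [? [? ?]]]; split=> /=]; lra.
by do ?apply: measurableI.
Qed.

Lemma fine_scale (R : realType) (c : R) (x : \bar R) : 0 <= c ->
  fine (c%:E * x)%E = c * fine x.
Proof.
move=> c0; have [->|c_neq0] := eqVneq c 0; first by rewrite mul0e mul0r.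
have cp : 0 < c by rewrite lt_neqAle eq_sym c_neq0.
by case: x => [r| |] //=; rewrite ?gt0_muley ?gt0_muleNy ?lte_fin//= mulr0.
Qed.

(** The affine map with linear part [invmx (edge_mx T)] that computes the
    barycentric coordinates carries the hull onto the reference triangle. *)
Lemma areaE (R : realType) (T : 'M[R]_(3, 2)) : edge_mx T \in unitmx ->
  area T = `|\det (edge_mx T)| * fine (mu2 (@triangle R)).
Proof.
move=> uT; pose N := invmx (edge_mx T); pose x := row ord0 T *m N.
have DN : N 0 0 * N 1 1 - N 1 0 * N 0 1 = (\det (edge_mx T))^-1.
  by rewrite -det_inv det_mx2; ring.
have D0 : \det (edge_mx T) != 0 by rewrite -unitfE -unitmxE.
rewrite /area.
have -> : @vec2 R @^-1` hull T
    = affine2 (N 0 0) (N 1 0) (N 0 1) (N 1 1) (- x 0 0) (- x 0 1) @^-1` @triangle R.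
  apply/funext => -[a b]; apply/propext; rewrite /preimage /mkset (hull_unitmx _ uT).
  rewrite mulmxBl -/N -/x.
  have vE j : (vec2 (a, b) *m N - x) 0 j = N 0 j * a + N 1 j * b - x 0 j.
    rewrite !mxE !big_ord_recl big_ord0 !mxE /= addr0 mulrC [b * _]mulrC.
    by do ![congr (_ + _)]; congr (N _ _ * _); apply/val_inj.
  have e1 : lift (0 : 'I_2) (0 : 'I_1) = 1 by apply/val_inj.
  rewrite !big_ord_recl big_ord0 addr0 !vE e1 /triangle /affine2 /=.
  split=> [[v0 v1]|[v0 v1 v2]]; first by split=> //; rewrite -vE; exact: v0.
  split=> // i; have [->|->] : i = 0 \/ i = 1; rewrite ?vE//.
  by case: i => -[|[|//]] ?; [left|right]; apply/val_inj.
rewrite measure_affine2 ?DN; [|by rewrite invr_eq0|exact: measurable_triangle].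
by rewrite fine_scale ?invr_ge0// normrV ?unitfE// invrK.
Qed.

Lemma volumeE (R : realType) (T : 'M[R]_(4, 3)) : edge_mx T \in unitmx ->
  volume T = `|\det (edge_mx T)| * fine (mu3 (@tetrahedron R)).
Proof.
move=> uT; pose N := invmx (edge_mx T); pose x := row ord0 T *m N.
pose D := N 0 0 * (N 1 1 * N 2%:R 2%:R - N 2%:R 1 * N 1 2%:R)
        - N 1 0 * (N 0 1 * N 2%:R 2%:R - N 2%:R 1 * N 0 2%:R)
        + N 2%:R 0 * (N 0 1 * N 1 2%:R - N 1 1 * N 0 2%:R).
have DN : D = (\det (edge_mx T))^-1.
  by rewrite -det_inv det_mx3 /D /N; ring.
have D0 : \det (edge_mx T) != 0 by rewrite -unitfE -unitmxE.
rewrite /volume.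
have -> : @vec3 R @^-1` hull T
    = affine3 (N 0 0) (N 1 0) (N 2%:R 0) (N 0 1) (N 1 1) (N 2%:R 1)
        (N 0 2%:R) (N 1 2%:R) (N 2%:R 2%:R) (- x 0 0) (- x 0 1) (- x 0 2%:R)
        @^-1` @tetrahedron R.
  apply/funext => -[[a b] c]; apply/propext; rewrite /preimage /mkset (hull_unitmx _ uT).
  rewrite mulmxBl -/N -/x.
  have vE j : (vec3 (a, b, c) *m N - x) 0 j
      = N 0 j * a + N 1 j * b + N 2%:R j * c - x 0 j.
    rewrite !mxE !big_ord_recl big_ord0 !mxE /= addr0 mulrC [b * _]mulrC [c * _]mulrC addrA.
    by do ![congr (_ + _)]; congr (N _ _ * _); apply/val_inj.
  have e1 : lift (0 : 'I_3) (0 : 'I_2) = 1 by apply/val_inj.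
  have e2 : lift (0 : 'I_3) (lift (0 : 'I_2) (0 : 'I_1)) = 2%:R by apply/val_inj.
  rewrite !big_ord_recl big_ord0 addr0 !vE e1 e2 /tetrahedron /affine3 /= addrA.
  split=> [[v0 v1]|[v0 v1 v2 v3]]; first by split=> //; rewrite -vE; exact: v0.
  split=> // i; have [->|[->|->]] : i = 0 \/ i = 1 \/ i = 2%:R; rewrite ?vE//.
  by case: i => -[|[|[|//]]] ?; [left|right; left|right; right]; apply/val_inj.
rewrite measure_affine3 -/D ?DN; [|by rewrite invr_eq0|exact: measurable_tetrahedron].
by rewrite fine_scale ?invr_ge0// normrV ?unitfE// invrK.
Qed.

(** The reference triangle contains a square of side 1/2 and is contained in the
    unit square; finiteness matters because [fine] sends infinity to 0. *)
Lemma area_triangle_gt0 (R : realType) : 0 < fine (mu2 (@triangle R)).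
Proof.
pose I (a : R) : set (line R) := [set` `[0, a]].
have mI a : measurable (I a) by exact: measurable_itv.
have muI a : 0 <= a -> mu1 (I a) = a%:E.
  move=> a0; rewrite /I lebesgue_measure_itv/= lte_fin oppr0 adde0.
  by case: ltgtP a0 => // <-.
have muII a : 0 <= a -> mu2 (I a `*` I a) = (a * a)%:E.
  move=> a0; transitivity (mu1 (I a) * mu1 (I a))%E; last by rewrite muI.
  exact: product_measure1E.
have sub1 : I 2^-1 `*` I 2^-1 `<=` @triangle R.
  by move=> -[x y] []; rewrite /I /= !in_itv/= => /andP[? ?] /andP[? ?]; split=> /=; lra.
have sub2 : @triangle R `<=` I 1 `*` I 1.
  by move=> -[x y] [] /= ? ? ?; split; rewrite /I /= in_itv/=; apply/andP; split; lra.
have le1 : (mu2 (I 2^-1%R `*` I 2^-1%R) <= mu2 (@triangle R))%E.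
  by apply: le_measure => //; rewrite inE; [exact: measurableX|exact: measurable_triangle].
have le2 : (mu2 (@triangle R) <= mu2 (I 1%R `*` I 1%R))%E.
  by apply: le_measure => //; rewrite inE; [exact: measurable_triangle|exact: measurableX].
rewrite muII in le1; last by lra.
rewrite muII in le2; last by lra.
rewrite fine_gt0//; apply/andP; split.
  by apply: lt_le_trans le1; rewrite lte_fin; lra.
by apply: le_lt_trans le2 _; rewrite ltry.
Qed.

(** * Edge lengths, diameters and congruence *)

Section Euclid.
Variables (R : realType) (d : nat).
Implicit Types (u v w : 'rV[R]_d) (T : 'M[R]_(d.+1, d)).

Lemma dotE u v : dot u v = (u *m v^T) 0 0.
Proof. by rewrite mxE; apply: eq_bigr => i _; rewrite mxE. Qed.

Lemma dotC u v : dot u v = dot v u.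
Proof. by apply: eq_bigr => i _; rewrite mulrC. Qed.

Lemma dotBl u v w : dot (u - v) w = dot u w - dot v w.
Proof. by rewrite !dotE mulmxBl !mxE. Qed.

Lemma dotZl a u w : dot (a *: u) w = a * dot u w.
Proof. by rewrite !dotE -scalemxAl mxE. Qed.

Lemma dotBB u v : dot (u - v) (u - v) = dot u u + dot v v - 2 * dot u v.
Proof. by rewrite dotBl ![dot _ (u - v)]dotC !dotBl (dotC v u); ring. Qed.

Lemma dot_ge0 u : 0 <= dot u u.
Proof. by apply: sumr_ge0 => i _; rewrite -expr2 sqr_ge0. Qed.

Lemma dot_eq0 u : (dot u u == 0) = (u == 0).
Proof.
apply/eqP/eqP => [u0|->]; last by rewrite /dot big1// => i _; rewrite mxE mul0r.
apply/rowP => i; rewrite mxE; apply/eqP; rewrite -sqrf_eq0 expr2; apply/eqP.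
by apply: (psumr_eq0P _ u0) => // j _; rewrite -expr2 sqr_ge0.
Qed.

Lemma enorm_ge0 u : 0 <= enorm u. Proof. exact: sqrtr_ge0. Qed.

Lemma enorm_sqr u : enorm u ^+ 2 = dot u u.
Proof. by rewrite sqr_sqrtr ?dot_ge0. Qed.

Lemma enorm_eq0 u : (enorm u == 0) = (u == 0).
Proof. by rewrite -sqrf_eq0 enorm_sqr dot_eq0. Qed.

(** The Cauchy-Schwarz inequality, obtained by expanding the square of the norm
    of |v| u - |u| v. *)
Lemma dot_le_enorm u v : dot u v <= enorm u * enorm v.
Proof.
have [->|v0] := eqVneq v 0.
  by rewrite dotC /dot big1 ?mulr_ge0 ?enorm_ge0// => i _; rewrite mxE mul0r.
have nv : 0 < enorm v by rewrite lt_neqAle eq_sym enorm_eq0 v0 enorm_ge0.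
have := dot_ge0 (enorm v *: u - enorm u *: v).
rewrite dotBB !dotZl ![dot _ (_ *: _)]dotC !dotZl -!enorm_sqr (dotC v u).
have [->|u0] := eqVneq u 0.
  by rewrite {2}/dot big1 ?mulr_ge0 ?enorm_ge0// => i _; rewrite mxE mul0r.
have nu : 0 < enorm u by rewrite lt_neqAle eq_sym enorm_eq0 u0 enorm_ge0.
have nuv := mulr_gt0 nu nv.
have -> : enorm v * (enorm v * enorm u ^+ 2) + enorm u * (enorm u * enorm v ^+ 2)
  - 2 * (enorm v * (enorm u * dot u v))
  = (enorm u * enorm v) * (2 * (enorm u * enorm v - dot u v)) by ring.
by rewrite pmulr_rge0// pmulr_rge0// subr_ge0.
Qed.

Lemma edistC u v : edist u v = edist v u.
Proof. by rewrite /edist /enorm !dotBB (dotC u v) [dot u u + _]addrC. Qed.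

Lemma edist_leD u v w : edist u w <= edist u v + edist v w.
Proof.
rewrite -ler_sqr ?nnegrE ?addr_ge0 ?enorm_ge0// sqrrD /edist.
have -> : u - w = (u - v) - (w - v) by rewrite opprB addrA subrK.
have := dot_le_enorm (u - v) (v - w); rewrite mulr2n !enorm_sqr (dotBB (u - v)).
have -> : dot (u - v) (w - v) = - dot (u - v) (v - w).
  by rewrite ![dot (u - v) _]dotC !dotBl; ring.
have -> : dot (w - v) (w - v) = dot (v - w) (v - w) by rewrite !dotBB (dotC v w); ring.
by lra.
Qed.

Lemma hull_row T i : hull T (row i T).
Proof.
exists (delta_mx 0 i); split; last by rewrite -rowE.
  by move=> j; rewrite mxE eqxx ler0n.
by rewrite (bigD1 i)//= !mxE !eqxx big1 ?addr0// => j ji; rewrite mxE (negPf ji) andbF.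
Qed.

(** A convex combination m of vectors u_i of norm at most D satisfies
    |m|^2 = sum_i w_i (u_i . m) <= D |m|. *)
Lemma edist_hull_le T p q D : (forall i, edist (row i T) q <= D) ->
  hull T p -> edist p q <= D.
Proof.
move=> leD [w [w0 w1 ->]].
have -> : edist (w *m T) q = enorm (\sum_i w 0 i *: (row i T - q)).
  rewrite /edist mulmx_sum_row; congr enorm.
  under [RHS]eq_bigr do rewrite scalerBr.
  by rewrite sumrB -scaler_suml w1 scale1r.
set m := \sum_i _.
have [->|m0] := eqVneq (enorm m) 0; first exact: le_trans (enorm_ge0 _) (leD ord0).
have mp : 0 < enorm m by rewrite lt_neqAle eq_sym m0 enorm_ge0.
rewrite -(ler_pM2r mp) -expr2 enorm_sqr dotE {1}/m mulmx_suml summxE.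
rewrite -[leRHS]mul1r -w1 mulr_suml; apply: ler_sum => i _.
rewrite -dotE dotZl ler_wpM2l//; apply: le_trans (dot_le_enorm _ _) _.
by rewrite ler_pM2r//; exact: leD.
Qed.

Lemma edist_hull2_le T p q D : (forall i j, edist (row i T) (row j T) <= D) ->
  hull T p -> hull T q -> edist p q <= D.
Proof.
move=> leD hp hq; apply: edist_hull_le hp => i; rewrite edistC.
by apply: edist_hull_le hq => j; rewrite edistC.
Qed.

Lemma diam_hull_le T D : (forall i j, edist (row i T) (row j T) <= D) ->
  diam (hull T) <= D.
Proof.
move=> leD; apply: ge_sup; last first.
  by move=> _ [p [q [hp hq ->]]]; exact: edist_hull2_le hp hq.
by exists (edist (row ord0 T) (row ord0 T)), (row ord0 T), (row ord0 T);
  split=> //; exact: hull_row.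
Qed.

Lemma edist_le_diam T i j : edist (row i T) (row j T) <= diam (hull T).
Proof.
apply: ub_le_sup; last by exists (row i T), (row j T); split=> //; exact: hull_row.
exists (\sum_k \sum_l edist (row k T) (row l T)) => _ [p [q [hp hq ->]]].
apply: (edist_hull2_le _ hp hq) => k l.
rewrite (bigD1 k)//= (bigD1 l)//= -addrA lerDl addr_ge0// ?sumr_ge0// => m _.
  exact: enorm_ge0.
by apply: sumr_ge0 => n _; exact: enorm_ge0.
Qed.

Lemma edist_move (Q : 'M[R]_d) b u v : Q *m Q^T = 1%:M ->
  edist (u *m Q + b) (v *m Q + b) = edist u v.
Proof.
move=> QQ; rewrite /edist /enorm opprD addrACA subrr addr0 -mulmxBl !dotE.
by rewrite trmx_mul mulmxA -(mulmxA (u - v)) QQ mulmx1.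
Qed.

Lemma congruent_sym T0 T : congruent T0 T -> congruent T T0.
Proof.
move=> [Q [b [s [QQ sE]]]]; exists Q^T, (- b *m Q^T), (s^-1)%g; split.
  by rewrite trmxK; exact: mulmx1C.
move=> i; rewrite -{2}(permKV s i) sE mulmxDl -mulmxA QQ mulmx1 mulNmx.
by rewrite addrK.
Qed.

Lemma congruent_diam T0 T : congruent T0 T -> diam (hull T0) = diam (hull T).
Proof.
suff le T1 T2 : congruent T1 T2 -> diam (hull T1) <= diam (hull T2).
  by move=> c; apply/eqP; rewrite eq_le !le//; exact: congruent_sym.
move=> [Q [b [s [QQ sE]]]]; apply: diam_hull_le => i j.
by rewrite -(edist_move b _ _ QQ) -!sE edist_le_diam.
Qed.

(** An edge is a pair of increasing indices, hence the sorting. *)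
Definition perm_edge (s : 'S_d.+1) (e : 'I_d.+1 * 'I_d.+1) :=
  if (s e.1 < s e.2)%N then (s e.1, s e.2) else (s e.2, s e.1).

Lemma perm_edgeP s e : edge e -> edge (perm_edge s e).
Proof.
rewrite /edge /perm_edge /mkset => lt_e; case: ifP => [//|/negbT].
rewrite -leqNgt leq_eqVlt => /orP[/eqP se|//].
have e12 : e.1 = e.2 by apply: (@perm_inj _ s); apply: val_inj; exact: esym se.
by rewrite e12 ltnn in lt_e.
Qed.

Lemma perm_edge_inj s e f : edge e -> edge f -> perm_edge s e = perm_edge s f -> e = f.
Proof.
case: e f => [e1 e2] [f1 f2]; rewrite /edge /perm_edge /mkset /= => lte ltf.
by case: ifP => _; case: ifP => _ [/perm_inj E1 /perm_inj E2]; rewrite ?E1 ?E2//;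
  move: lte; rewrite E1 E2 ltnNge (ltnW ltf).
Qed.

Lemma congruent_edge_length T0 T : congruent T0 T ->
  exists s, forall e, edge_length T (perm_edge s e) = edge_length T0 e.
Proof.
move=> [Q [b [s [QQ sE]]]]; exists s => e.
have -> : edge_length T (perm_edge s e) = edist (row (s e.1) T) (row (s e.2) T).
  by rewrite /perm_edge; case: ifP => // _; rewrite edistC.
by rewrite !sE edist_move.
Qed.

Lemma congruent_edge_lengths T0 T : congruent T0 T ->
  [set edge_length T0 e | e in @edge d.+1] = [set edge_length T e | e in @edge d.+1].
Proof.
suff sub T1 T2 : congruent T1 T2 ->
    [set edge_length T1 e | e in @edge d.+1] `<=` [set edge_length T2 e | e in @edge d.+1].
  by move=> c; apply/seteqP; split; apply: sub => //; exact: congruent_sym.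
move=> /congruent_edge_length[s sE] _ [e ee <-].
by exists (perm_edge s e) => //; exact: perm_edgeP.
Qed.

Definition edge_products T : set R :=
  [set r | exists e f, [/\ edge e, edge f, e <> f &
                           r = edge_length T e * edge_length T f]].

Lemma congruent_edge_products T0 T : congruent T0 T ->
  edge_products T0 = edge_products T.
Proof.
suff sub T1 T2 : congruent T1 T2 -> edge_products T1 `<=` edge_products T2.
  by move=> c; apply/seteqP; split; apply: sub => //; exact: congruent_sym.
move=> /congruent_edge_length[s sE] _ [e [f [ee ef ef_neq ->]]].
exists (perm_edge s e), (perm_edge s f); split; rewrite ?sE//; try exact: perm_edgeP.
by move=> /(perm_edge_inj ee ef)/ef_neq.
Qed.

End Euclid.

Lemma congruent_area (R : realType) (T0 T : 'M[R]_(3, 2)) :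
  affinely_independent T0 -> congruent T0 T -> area T = area T0.
Proof.
move=> aT0 /congruent_hull[T' [hT' dT' uT']].
have uT0 := affinely_independent_unitmx aT0.
have -> : area T = area T' by rewrite /area hT'.
by rewrite !areaE ?uT'// dT'.
Qed.

Lemma congruent_volume (R : realType) (T0 T : 'M[R]_(4, 3)) :
  affinely_independent T0 -> congruent T0 T -> volume T = volume T0.
Proof.
move=> aT0 /congruent_hull[T' [hT' dT' uT']].
have uT0 := affinely_independent_unitmx aT0.
have -> : volume T = volume T' by rewrite /volume hT'.
by rewrite !volumeE ?uT'// dT'.
Qed.

Lemma congruent_H2 (R : realType) (T0 T : 'M[R]_(3, 2)) :
  affinely_independent T0 -> congruent T0 T -> H2 T0 = H2 T.
Proof.
move=> aT0 c; rewrite /H2 (congruent_area aT0 c) (congruent_diam c).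
by rewrite (congruent_edge_lengths c).
Qed.

Lemma congruent_H3 (R : realType) (T0 T : 'M[R]_(4, 3)) :
  affinely_independent T0 -> congruent T0 T -> H3 T0 = H3 T.
Proof.
move=> aT0 c; rewrite /H3 (congruent_volume aT0 c) (congruent_diam c).
by rewrite -!/(edge_products _) (congruent_edge_products c).
Qed.

(** * Shortest and longest edges; standard positions *)

Section Extremal.
Variables (R : realType) (d : nat).
Implicit Types T : 'M[R]_(d.+1, d).

Lemma edge_length_ge0 T e : 0 <= edge_length T e.
Proof. exact: enorm_ge0. Qed.

Lemma diam_le_edges T D : 0 <= D ->
  (forall e, edge e -> edge_length T e <= D) -> diam (hull T) <= D.
Proof.
move=> D0 leD; apply: diam_hull_le => i j.
have [lt_ij|lt_ji|/val_inj ->] := ltngtP i j.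
- exact: (leD (i, j)).
- by rewrite edistC; exact: (leD (j, i)).
- rewrite /edist subrr /enorm /dot big1 ?sqrtr0// => k _.
  by rewrite mxE mul0r.
Qed.

Lemma longest_edge_diam T e : longest_edge T e -> diam (hull T) = edge_length T e.
Proof.
move=> [ee le_e]; apply/eqP; rewrite eq_le edist_le_diam andbT.
by apply: diam_le_edges => //; exact: edge_length_ge0.
Qed.

Lemma shortest_edge_inf T e : shortest_edge T e ->
  inf [set edge_length T f | f in @edge d.+1] = edge_length T e.
Proof.
move=> [ee le_e]; apply/eqP; rewrite eq_le; apply/andP; split.
  apply: ge_inf; last by exists e.
  by exists (edge_length T e) => _ [f ef <-]; exact: le_e.
apply: lb_le_inf; first by exists (edge_length T e), e.
by move=> _ [f ef <-]; exact: le_e.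
Qed.

(** Of two distinct edges, one differs from the shortest edge [e0], so it is at
    least b / 2, and the other one is at least a. *)
Lemma inf_edge_products T e0 f0 a b : shortest_edge T e0 -> edge f0 -> e0 <> f0 ->
  edge_length T e0 = a -> edge_length T f0 = b ->
  (forall f, edge f -> f <> e0 -> b <= 2 * edge_length T f) ->
  a * b / 2 <= inf (edge_products T) <= a * b.
Proof.
move=> [ee0 le_e0] ef0 ef_neq ea eb le_b.
have a0 : 0 <= a by rewrite -ea edge_length_ge0.
have lb r : edge_products T r -> a * b / 2 <= r.
  move=> [e [f [ee ef ef_neq' ->]]].
  have [e_e0|e_e0] := pselect (e = e0); last first.
    have := le_b e ee e_e0; have := le_e0 f ef; rewrite ea => af be.
    by rewrite -mulrA [leRHS]mulrC ler_pM//; [rewrite -eb divr_ge0 ?edge_length_ge0|lra].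
  have f_e0 : f <> e0 by move=> f_e0; apply: ef_neq'; rewrite e_e0 f_e0.
  have := le_b f ef f_e0; rewrite e_e0 ea => bf.
  by rewrite -mulrA ler_wpM2l//; lra.
have mem : edge_products T (a * b) by exists e0, f0; rewrite ea eb.
apply/andP; split; first by apply: lb_le_inf; [exists (a * b)|exact: lb].
by apply: ge_inf => //; exists (a * b / 2).
Qed.

End Extremal.

Lemma edge3P (e : 'I_3 * 'I_3) : edge e ->
  [\/ e = (inord 0, inord 1), e = (inord 0, inord 2) | e = (inord 1, inord 2)].
Proof.
case: e => [[[|[|[|//]]] i] [[|[|[|//]]] j]] //=; rewrite /edge /mkset //= => _;
  [apply: Or31|apply: Or32|apply: Or33];
  by congr (_, _); apply/val_inj; rewrite /= inordK.
Qed.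

Lemma edge4P (e : 'I_4 * 'I_4) : edge e -> e \in
  [:: (inord 0, inord 1); (inord 0, inord 2); (inord 0, inord 3);
      (inord 1, inord 2); (inord 1, inord 3); (inord 2, inord 3)].
Proof.
have ordE n (i : (n < 4)%N) : Ordinal i = inord n by apply/val_inj; rewrite /= inordK.
by case: e => [[[|[|[|[|//]]]] i] [[|[|[|[|//]]]] j]] //=; rewrite /edge /mkset //= => _;
  rewrite !ordE !inE !eqxx ?orbT.
Qed.

Lemma area_ge0 (R : realType) (T : 'M[R]_(3, 2)) : 0 <= area T.
Proof. exact/fine_ge0/measure_ge0. Qed.

Lemma volume_ge0 (R : realType) (T : 'M[R]_(4, 3)) : 0 <= volume T.
Proof. exact/fine_ge0/measure_ge0. Qed.

Lemma edge_length_eq (R : realType) (d : nat) (T : 'M[R]_(d.+1, d)) e r :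
  0 <= r -> edge_length T e ^+ 2 = r ^+ 2 -> edge_length T e = r.
Proof. by move=> r0 /eqP; rewrite eqrXn2 ?edge_length_ge0// => /eqP. Qed.

Lemma edge_length_matrix_of_rows (R : realType) (d : nat) (X : seq (seq R)) m n :
  (m < d.+1)%N -> (n < d.+1)%N ->
  edge_length (matrix_of_rows d.+1 d X) (inord m, inord n) ^+ 2
    = \sum_(0 <= k < d) (nth 0 (nth [::] X m) k - nth 0 (nth [::] X n) k) ^+ 2.
Proof.
move=> lt_m lt_n; rewrite /edge_length /edist enorm_sqr big_mkord.
by apply: eq_bigr => k _; rewrite !mxE /= !inordK// expr2.
Qed.

(** The longest edge is h and the shortest one is a2, so the quotient of the two
    quantities is a1 / h; and h <= a1 + a2 <= 2 a1. *)
Lemma standard_H2_equiv (R : realType) (a1 a2 : R) (T : 'M[R]_(3, 2)) :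
  standard_position2 a1 a2 T ->
  2^-1 * H2 T <= standard_H2 a1 a2 T <= 1 * H2 T.
Proof.
move=> [a1_gt0 a2_gt0 [s [t [st t_gt0 TE long a21]]]].
have l01 : edge_length T (inord 0, inord 1) = a1.
  apply: edge_length_eq (ltW a1_gt0) _.
  by rewrite TE edge_length_matrix_of_rows// !big_nat_recr// big_geq//=; ring.
have l02 : edge_length T (inord 0, inord 2) = a2.
  apply: edge_length_eq (ltW a2_gt0) _.
  rewrite TE edge_length_matrix_of_rows// !big_nat_recr// big_geq//=.
  by rewrite -[RHS]mulr1 -st; ring.
have hE := longest_edge_diam long; set h := edge_length T _ in hE.
have a1h : a1 <= h by rewrite -l01; apply: long.2; rewrite /edge /mkset /= !inordK.
have ha1 : h <= 2 * a1.
  have := edist_leD (row (inord 1) T) (row (inord 0) T) (row (inord 2) T).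
  rewrite [edist _ (row (inord 0) T)]edistC.
  rewrite -/(edge_length T (inord 0, inord 1)) -/(edge_length T (inord 0, inord 2)).
  by rewrite -/(edge_length T (inord 1, inord 2)) l01 l02 -/h; lra.
have short : shortest_edge T (inord 0, inord 2).
  split=> [|f /edge3P[] ->]; first by rewrite /edge /mkset /= !inordK.
  - by rewrite l01 l02.
  - by [].
  - by rewrite l02 -/h; lra.
rewrite /H2 /standard_H2 (shortest_edge_inf short) hE l02 mul1r.
have Aa : 0 <= a2 * h / area T.
  by rewrite divr_ge0 ?area_ge0// mulr_ge0//; lra.
have -> : h ^+ 2 / area T * a2 = h * (a2 * h / area T) by ring.
have -> : a1 * a2 / area T * h = a1 * (a2 * h / area T) by ring.
by rewrite [_ * (h * _)]mulrA; apply/andP; split; apply: ler_wpM2r => //; lra.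
Qed.

(** The conditions that define the standard position are used as follows.
    Every edge adjacent to the shortest edge is at most a1, and the remaining
    edge is at most a1 (Type ii) or at most a1 + a3 <= 2 a1 (Type i); so h lies
    between a1 and 2 a1. The condition a3 s21 <= a1 / 2 says that x4 is at least
    as close to x1 as to x2, so that a3 is at most |x2 x4|, and then at most a1
    since one of the edges x1 x4 and x2 x4 is adjacent to the shortest one.
    By the triangle inequality and the minimality of a2, two edges that form a
    triangle with the shortest edge differ by at most a2, hence by at most a
    factor 2. Consequently a3 is at most twice any edge other than the shortest
    one, and [inf_edge_products] applies. *)
Lemma standard_H3_equiv (R : realType) (a1 a2 a3 : R) (T : 'M[R]_(4, 3)) :
  standard_position3 a1 a2 a3 T ->
  2^-1 * H3 T <= standard_H3 a1 a2 a3 T <= 2 * H3 T.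
Proof.
move=> [a1_gt0 a2_gt0 a3_gt0 [s1 [t1 [s21 [s22 [t2
  [[st1 _ _ _] [st2 _ a3s21] _ typ]]]]]]].
suff [a1_le_h h_le prodP] : [/\ a1 <= diam (hull T), diam (hull T) <= 2 * a1 &
    a2 * a3 / 2 <= inf (edge_products T) <= a2 * a3].
  rewrite /H3 /standard_H3 -/(edge_products T).
  move: prodP a1_le_h h_le => /andP[].
  set P := inf _; set h := diam _ => P1 P2 h1 h2.
  have a23 := mulr_gt0 a2_gt0 a3_gt0.
  set V := h / volume T; have V0 : 0 <= V by rewrite divr_ge0 ?volume_ge0//; lra.
  have -> : h ^+ 2 / volume T * P = h * P * V by rewrite /V; ring.
  have -> : a1 * a2 * a3 / volume T * h = a1 * (a2 * a3) * V by rewrite /V; ring.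
  rewrite ![_ * (h * P * V)]mulrA.
  apply/andP; split; apply: ler_wpM2r => //.
    by rewrite mulrA; apply: ler_pM => //; lra.
  have -> : 2 * (h * P) = h * (2 * P) by ring.
  by apply: ler_pM; lra.
have edgeI i j : (i < j < 4)%N -> edge (inord i : 'I_4, inord j : 'I_4).
  by move=> /andP[ij j4]; rewrite /edge /mkset /= !inordK// (ltn_trans ij).
have edge_neq i j k l : (i < 4)%N -> (j < 4)%N -> (k < 4)%N -> (l < 4)%N ->
    (i, j) != (k, l) -> (inord i : 'I_4, inord j : 'I_4) <> (inord k, inord l).
  move=> ? ? ? ? /eqP neq [] /(congr1 val) /= + /(congr1 val) /=.
  by rewrite !inordK// => ik jl; apply: neq; rewrite ik jl.
pose len i j := edge_length T (inord i, inord j).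
have lenE i j : edge_length T (inord i, inord j) = len i j by [].
have tri i j k : len i k <= len i j + len j k by exact: edist_leD.
have lenC i j : len i j = len j i by exact: edistC.
have lenP i j r X : T = matrix_of_rows 4 3 X -> (i < 4)%N -> (j < 4)%N -> 0 < r ->
    (nth 0 (nth [::] X i) 0 - nth 0 (nth [::] X j) 0) ^+ 2
      + (nth 0 (nth [::] X i) 1 - nth 0 (nth [::] X j) 1) ^+ 2
      + (nth 0 (nth [::] X i) 2 - nth 0 (nth [::] X j) 2) ^+ 2 = r ^+ 2 ->
    len i j = r.
  move=> TE i4 j4 r0 rE; apply: edge_length_eq (ltW r0) _.
  rewrite -rE TE edge_length_matrix_of_rows//.
  by rewrite !big_nat_recr// big_geq//= add0r.
have [x3 TE] : exists x3, T = matrix_of_rows 4 3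
    [:: [:: 0; 0; 0]; [:: a1; 0; 0]; x3; [:: a3 * s21; a3 * s22; a3 * t2]].
  by case: typ => -[TE _ _ _]; eexists; exact: TE.
have l01 : len 0 1 = a1 by apply: (lenP _ _ _ _ TE) => //=; ring.
have l03 : len 0 3 = a3.
  by apply: (lenP _ _ _ _ TE) => //=; rewrite -[RHS]mulr1 -st2; ring.
have l13 : a3 <= len 1 3.
  rewrite -ler_sqr ?nnegrE ?edge_length_ge0 ?(ltW a3_gt0)//.
  rewrite -lenE TE edge_length_matrix_of_rows// !big_nat_recr// big_geq//= add0r.
  have a31 : 0 <= a1 * (a1 - 2 * (a3 * s21)) by rewrite mulr_ge0//; lra.
  rewrite -[leLHS]mulr1 -st2 -subr_ge0; apply: le_trans a31 _.
  by rewrite le_eqVlt; apply/orP; left; apply/eqP; ring.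
have a1_diam : a1 <= diam (hull T) by rewrite -l01; exact: edist_le_diam.
case: typ => -[{}TE [_ short] [_ _ adj] _].
- have l02 : len 0 2 = a2.
    by apply: (lenP _ _ _ _ TE) => //=; rewrite -[RHS]mulr1 -st1; ring.
  rewrite lenE l01 in adj; rewrite lenE l02 in short.
  clearbody len; clear TE lenP st1 st2 a3s21.
  have shortP i j : (i < j < 4)%N -> a2 <= len i j.
    by move=> ij; rewrite -lenE; apply: short; exact: edgeI.
  have l03a1 : a3 <= a1.
    rewrite -l03 -lenE; apply: adj; first exact: edgeI.
    by split; [exact: edge_neq|rewrite /= eqxx].
  have l12a1 : len 1 2 <= a1.
    rewrite -lenE; apply: adj; first exact: edgeI.
    by split; [exact: edge_neq|rewrite /= eqxx ?orbT].
  have l23a1 : len 2 3 <= a1.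
    rewrite -lenE; apply: adj; first exact: edgeI.
    by split; [exact: edge_neq|rewrite /= eqxx ?orbT].
  have := shortP 0 1 isT; have := shortP 1 2 isT; have := shortP 2 3 isT.
  have := tri 1 0 3; have := tri 0 2 1; have := tri 0 2 3.
  rewrite (lenC 1 0) (lenC 2 1) l01 l02 l03 => t03 t01 t13 s23 s12 s01.
  split=> //.
    apply: diam_le_edges => [|e /edge4P]; first by lra.
    by rewrite !inE => /or4P[|||/or3P[]] /eqP ->; rewrite lenE ?l01 ?l02 ?l03; lra.
  apply: (@inf_edge_products _ _ T (inord 0, inord 2) (inord 0, inord 3)) => //.
  + by split; [exact: edgeI|rewrite lenE l02].
  + exact: edgeI.
  + exact: edge_neq.
  + by rewrite lenE.
  + by rewrite lenE.
  + move=> f /edge4P; rewrite !inE => /or4P[|||/or3P[]] /eqP -> //= _;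
      rewrite lenE ?l01 ?l03; lra.
- have l12 : len 1 2 = a2.
    by apply: (lenP _ _ _ _ TE) => //=; rewrite -[RHS]mulr1 -st1; ring.
  rewrite lenE l01 in adj; rewrite lenE l12 in short.
  clearbody len; clear TE lenP st1 st2 a3s21.
  have shortP i j : (i < j < 4)%N -> a2 <= len i j.
    by move=> ij; rewrite -lenE; apply: short; exact: edgeI.
  have l02a1 : len 0 2 <= a1.
    rewrite -lenE; apply: adj; first exact: edgeI.
    by split; [exact: edge_neq|rewrite /= eqxx ?orbT].
  have l13a1 : len 1 3 <= a1.
    rewrite -lenE; apply: adj; first exact: edgeI.
    by split; [exact: edge_neq|rewrite /= eqxx ?orbT].
  have l23a1 : len 2 3 <= a1.
    rewrite -lenE; apply: adj; first exact: edgeI.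
    by split; [exact: edge_neq|rewrite /= eqxx ?orbT].
  have := shortP 0 1 isT; have := shortP 0 2 isT; have := shortP 2 3 isT.
  have := tri 1 2 3; have := tri 0 2 1.
  rewrite (lenC 2 1) l01 l12 => t01 t13 s23 s02 s01.
  split=> //.
    apply: diam_le_edges => [|e /edge4P]; first by lra.
    by rewrite !inE => /or4P[|||/or3P[]] /eqP ->; rewrite lenE ?l01 ?l12 ?l03; lra.
  apply: (@inf_edge_products _ _ T (inord 1, inord 2) (inord 0, inord 3)) => //.
  + by split; [exact: edgeI|rewrite lenE l12].
  + exact: edgeI.
  + exact: edge_neq.
  + by rewrite lenE.
  + by rewrite lenE.
  + move=> f /edge4P; rewrite !inE => /or4P[|||/or3P[]] /eqP -> //= _;
      rewrite lenE ?l01 ?l03; lra.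
Qed.

(** * The circumradius *)

Lemma ordS3 (i : 'I_3) : ordS (ordS (ordS i)) = i.
Proof. by apply/val_inj; case: i => -[|[|[|//]]]. Qed.

Lemma ordS_cases (i j : 'I_3) : [\/ j = i, j = ordS i | j = ordS (ordS i)].
Proof.
by case: i j => -[|[|[|//]]] ? [[|[|[|//]]] ?];
  (by apply: Or31; apply/val_inj) || (by apply: Or32; apply/val_inj)
  || (by apply: Or33; apply/val_inj).
Qed.

Section Triangle.
Variable (R : realType).
Implicit Types (u v w : 'rV[R]_2) (T : 'M[R]_(3, 2)).

Definition cross u v : R := u 0 0 * v 0 1 - u 0 1 * v 0 0.

Lemma dot2E u v : dot u v = u 0 0 * v 0 0 + u 0 1 * v 0 1.
Proof.
rewrite /dot !big_ord_recl big_ord0 addr0.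
by have -> : lift (0 : 'I_2) (0 : 'I_1) = 1 by apply/val_inj.
Qed.

Lemma dot_cross u v : dot u v ^+ 2 + cross u v ^+ 2 = dot u u * dot v v.
Proof. by rewrite !dot2E /cross; ring. Qed.

Lemma cross_vertex T i :
  cross (row (ordS i) T - row i T) (row (ordS (ordS i)) T - row i T)
    = \det (edge_mx T).
Proof.
have rot k : cross (row (ordS (ordS k)) T - row (ordS k) T)
      (row (ordS (ordS (ordS k))) T - row (ordS k) T)
    = cross (row (ordS k) T - row k T) (row (ordS (ordS k)) T - row k T).
  by rewrite ordS3 /cross !mxE; ring.
have e0 : cross (row (ordS ord0) T - row ord0 T)
    (row (ordS (ordS ord0)) T - row ord0 T) = \det (edge_mx T).
  rewrite det_mx2 /cross !mxE.
  have -> : lift ord0 (0 : 'I_2) = ordS ord0 :> 'I_3 by apply/val_inj.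
  by have -> : lift ord0 (1 : 'I_2) = ordS (ordS ord0) :> 'I_3 by apply/val_inj.
by have [->|->|->] := ordS_cases ord0 i; rewrite ?rot.
Qed.

(** The hypotheses say that w is at the same distance from 0, u and v. They are
    a linear system for w, with determinant [cross u v] up to a factor 2, and
    Cramer's rule gives the squared norm of w. *)
Lemma equidistant u v w : 2 * dot u w = dot u u -> 2 * dot v w = dot v v ->
  4 * dot w w * cross u v ^+ 2 = dot u u * dot v v * dot (u - v) (u - v).
Proof.
move=> uw vw.
have E0 : 2 * cross u v * w 0 0 = dot u u * v 0 1 - dot v v * u 0 1.
  by rewrite -uw -vw !dot2E /cross; ring.
have E1 : 2 * cross u v * w 0 1 = u 0 0 * dot v v - v 0 0 * dot u u.
  by rewrite -uw -vw !dot2E /cross; ring.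
have -> : 4 * dot w w * cross u v ^+ 2
    = (2 * cross u v * w 0 0) ^+ 2 + (2 * cross u v * w 0 1) ^+ 2.
  by rewrite dot2E; ring.
by rewrite E0 E1 dotBB !dot2E; ring.
Qed.

Lemma circumcenter_exists T : affinely_independent T ->
  exists r, exists c : 'rV[R]_2, forall i, edist (row i T) c = r.
Proof.
move=> /affinely_independent_unitmx uT.
pose u := row (ordS ord0) T - row ord0 T.
pose v := row (ordS (ordS ord0)) T - row ord0 T.
have D0 : cross u v != 0 by rewrite cross_vertex -unitfE -unitmxE.
(* The solution by Cramer's rule of 2 u . w = |u|^2, 2 v . w = |v|^2. *)
pose w : 'rV[R]_2 := \row_(i < 2) ((2 * cross u v)^-1 *
  (if i == 0 then dot u u * v 0 1 - dot v v * u 0 1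
   else u 0 0 * dot v v - v 0 0 * dot u u)).
have w0 : w 0 0 = (2 * cross u v)^-1 * (dot u u * v 0 1 - dot v v * u 0 1) by rewrite mxE.
have w1 : w 0 1 = (2 * cross u v)^-1 * (u 0 0 * dot v v - v 0 0 * dot u u) by rewrite mxE.
have uw : 2 * dot u w = dot u u.
  by move: D0; rewrite (dot2E u w) w0 w1 !dot2E /cross => D0; field.
have vw : 2 * dot v w = dot v v.
  by move: D0; rewrite (dot2E v w) w0 w1 !dot2E /cross => D0; field.
exists (enorm w), (row ord0 T + w) => i.
have eqd p : 2 * dot (p - row ord0 T) w = dot (p - row ord0 T) (p - row ord0 T) ->
    edist p (row ord0 T + w) = enorm w.
  move=> pw; rewrite /edist /enorm opprD addrA dotBB -pw.
  by congr Num.sqrt; ring.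
have [->|->|->] := ordS_cases ord0 i; apply: eqd => //.
by rewrite subrr !dot2E !mxE !mul0r addr0 mulr0.
Qed.

Lemma circumradiusP T : affinely_independent T ->
  exists c, forall i, edist (row i T) c = circumradius T.
Proof.
move=> /circumcenter_exists[r rP]; rewrite /circumradius.
by apply: (@xgetPex _ 0 [set r | exists c, forall i, edist (row i T) c = r]); exists r.
Qed.

Lemma circumradius_ge0 T : affinely_independent T -> 0 <= circumradius T.
Proof. by move=> /circumradiusP[c /(_ ord0) <-]; exact: enorm_ge0. Qed.

Lemma circumradius_sqr T i : affinely_independent T ->
  let u := row (ordS i) T - row i T in
  let v := row (ordS (ordS i)) T - row i T in
  4 * circumradius T ^+ 2 * \det (edge_mx T) ^+ 2
    = dot u u * dot v v * dot (u - v) (u - v).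
Proof.
move=> /circumradiusP[c cR] u v; pose w := c - row i T.
have wR : dot w w = circumradius T ^+ 2.
  by rewrite -(cR i) edistC -enorm_sqr.
have half j : 2 * dot (row j T - row i T) w = dot (row j T - row i T) (row j T - row i T).
  have : dot ((row j T - row i T) - w) ((row j T - row i T) - w) = dot w w.
    rewrite wR -(cR j) -enorm_sqr /edist; congr (enorm _ ^+ 2).
    by rewrite /w opprB addrA subrK.
  by rewrite dotBB => h; lra.
by rewrite -wR -(cross_vertex T i) (equidistant (half _) (half _)).
Qed.

(** The formula R = a b c / (4 area), as the absolute value of the determinant
    is twice the area. *)
Lemma circumradius_edges T i : affinely_independent T ->
  2 * circumradius T * `|\det (edge_mx T)|
    = edist (row (ordS i) T) (row i T) * edist (row (ordS (ordS i)) T) (row i T)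
      * edist (row (ordS i) T) (row (ordS (ordS i)) T).
Proof.
move=> aT; apply/eqP; rewrite -(@eqrXn2 _ 2)//; first last.
- by rewrite !mulr_ge0 ?enorm_ge0.
- by rewrite !mulr_ge0 ?circumradius_ge0.
rewrite !exprMn real_normK ?num_real// !enorm_sqr; apply/eqP.
have := circumradius_sqr i aT => /=.
have -> : row (ordS i) T - row i T - (row (ordS (ordS i)) T - row i T)
   = row (ordS i) T - row (ordS (ordS i)) T by rewrite opprB addrA subrK.
by move=> <-; ring.
Qed.

Lemma diam_vertex T i D :
  edist (row (ordS i) T) (row i T) <= D ->
  edist (row (ordS (ordS i)) T) (row i T) <= D ->
  edist (row (ordS i) T) (row (ordS (ordS i)) T) <= D ->
  diam (hull T) <= D.
Proof.
move=> l1 l2 l3.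
have D0 : 0 <= D by apply: le_trans (enorm_ge0 _) l1.
have z p : edist p p <= D :> R.
  by rewrite /edist subrr /enorm /dot big1 ?sqrtr0// => k _; rewrite mxE mul0r.
apply: diam_hull_le => j k.
by have [->|->|->] := ordS_cases i j; have [->|->|->] := ordS_cases i k => //;
  rewrite edistC.
Qed.

(** In x <= y <= z with z <= x + y the middle length y lies between z / 2 and z,
    which compares x y z with x z^2. *)
Lemma product_of_edges (a b c m h : R) : 0 <= a -> 0 <= b -> 0 <= c ->
  a <= b + c -> b <= a + c -> c <= a + b ->
  [\/ m = a, m = b | m = c] -> m <= a -> m <= b -> m <= c ->
  [\/ h = a, h = b | h = c] -> a <= h -> b <= h -> c <= h ->
  a * b * c <= h ^+ 2 * m <= 2 * (a * b * c).
Proof.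
have key (x y z : R) : 0 <= x -> x <= y -> y <= z -> z <= x + y ->
    x * y * z <= z ^+ 2 * x <= 2 * (x * y * z).
  move=> x0 xy yz zxy.
  have xz : 0 <= x * z by rewrite mulr_ge0//; lra.
  have -> : x * y * z = x * z * y by ring.
  have -> : z ^+ 2 * x = x * z * z by ring.
  have -> : 2 * (x * z * y) = x * z * (2 * y) by ring.
  by apply/andP; split; apply: ler_wpM2l => //; lra.
move=> a0 b0 c0 abc bac cab mE ma mb mc hE ha hb hc.
have abC : a * b * c = b * a * c by ring.
have acC : a * b * c = a * c * b by ring.
have bcC : a * b * c = b * c * a by ring.
have caC : a * b * c = c * a * b by ring.
have cbC : a * b * c = c * b * a by ring.
case: mE => mE; case: hE => hE; subst m h.
- by have [-> ->] : b = a /\ c = a by [lra|]; apply: key; lra.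
- by rewrite acC; apply: key; lra.
- by apply: key; lra.
- by rewrite bcC; apply: key; lra.
- by have [-> ->] : a = b /\ c = b by [lra|]; apply: key; lra.
- by rewrite abC; apply: key; lra.
- by rewrite cbC; apply: key; lra.
- by rewrite caC; apply: key; lra.
- by have [-> ->] : a = c /\ b = c by [lra|]; apply: key; lra.
Qed.

Lemma longest_edge_exists T : exists e, longest_edge T e.
Proof.
pose e0 : 'I_3 * 'I_3 := (inord 0, inord 1).
have e0e : (e0.1 < e0.2)%N by rewrite /= !inordK.
exists [arg max_(e > e0 | (e.1 < e.2)%N) edge_length T e]%O.
by case: Order.TotalTheory.arg_maxP => // k ek kmax; split.
Qed.

Lemma shortest_edge_exists T : exists e, shortest_edge T e.
Proof.
pose e0 : 'I_3 * 'I_3 := (inord 0, inord 1).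
have e0e : (e0.1 < e0.2)%N by rewrite /= !inordK.
exists [arg min_(e < e0 | (e.1 < e.2)%N) edge_length T e]%O.
by case: Order.TotalTheory.arg_minP => // k ek kmin; split.
Qed.

(** With D the absolute value of the determinant, 2 R D is a b c and K D H is
    h^2 min(a, b, c). *)
Lemma H2_circumradius T (K := fine (mu2 (@triangle R))) : affinely_independent T ->
  2 / K * circumradius T <= H2 T <= 4 / K * circumradius T.
Proof.
move=> aT; have uT := affinely_independent_unitmx aT.
have K0 : 0 < K by exact: area_triangle_gt0.
have [e eL] := longest_edge_exists T; have [f fS] := shortest_edge_exists T.
have o0 : inord 0 = ord0 :> 'I_3 by apply/val_inj; rewrite /= inordK.
have o1 : inord 1 = ordS ord0 :> 'I_3 by apply/val_inj; rewrite /= inordK.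
have o2 : inord 2 = ordS (ordS ord0) :> 'I_3 by apply/val_inj; rewrite /= inordK.
have D0 : 0 < `|\det (edge_mx T)| by rewrite normr_gt0 -unitfE -unitmxE.
have := circumradius_edges ord0 aT.
rewrite /H2 (longest_edge_diam eL) (shortest_edge_inf fS) areaE// -/K -o2 -o1 -o0.
set D := `|_| in D0 *.
set a := edist _ _; set b := edist (row (inord 2) T) _; set c := edist _ (row (inord 2) T).
have l01 : edge_length T (inord 0, inord 1) = a by exact: edistC.
have l02 : edge_length T (inord 0, inord 2) = b by exact: edistC.
have l12 : edge_length T (inord 1, inord 2) = c by [].
have e01 : edge (inord 0 : 'I_3, inord 1 : 'I_3) by rewrite /edge /mkset /= !inordK.
have e02 : edge (inord 0 : 'I_3, inord 2 : 'I_3) by rewrite /edge /mkset /= !inordK.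
have e12 : edge (inord 1 : 'I_3, inord 2 : 'I_3) by rewrite /edge /mkset /= !inordK.
move=> RE.
have : a * b * c <= edge_length T e ^+ 2 * edge_length T f <= 2 * (a * b * c).
  apply: product_of_edges; rewrite ?enorm_ge0//.
  - by rewrite addrC; exact: edist_leD.
  - have -> : c = edist (row (inord 2) T) (row (inord 1) T) by exact: edistC.
    by rewrite addrC; exact: edist_leD.
  - have -> : b = edist (row (inord 0) T) (row (inord 2) T) by exact: edistC.
    exact: edist_leD.
  - by case: (edge3P fS.1) => ->; rewrite ?l01 ?l02 ?l12;
      [apply: Or31|apply: Or32|apply: Or33].
  - by rewrite -l01; exact: fS.2.
  - by rewrite -l02; exact: fS.2.
  - by rewrite -l12; exact: fS.2.
  - by case: (edge3P eL.1) => ->; rewrite ?l01 ?l02 ?l12;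
      [apply: Or31|apply: Or32|apply: Or33].
  - by rewrite -l01; exact: eL.2.
  - by rewrite -l02; exact: eL.2.
  - by rewrite -l12; exact: eL.2.
set h := edge_length T e; set m := edge_length T f; rewrite -RE => hm.
have -> : h ^+ 2 / (D * K) * m = h ^+ 2 * m / (D * K) by ring.
rewrite ler_pdivlMr ?ler_pdivrMr ?mulr_gt0//.
have -> : 2 / K * circumradius T * (D * K) = 2 * circumradius T * D.
  by field; rewrite gt_eqF.
have -> : 4 / K * circumradius T * (D * K) = 2 * (2 * circumradius T * D).
  by field; rewrite gt_eqF.
exact: hm.
Qed.

(** By the Cauchy-Schwarz inequality the quotient lies in the interval where
    [acos] is the inverse of [cos]. *)
Lemma cos_interior_angle T i : affinely_independent T ->
  let u := row (ordS i) T - row i T in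
  let v := row (ordS (ordS i)) T - row i T in
  [/\ 0 < enorm u, 0 < enorm v, 0 <= interior_angle T i <= pi &
    cos (interior_angle T i) = dot u v / (enorm u * enorm v)].
Proof.
move=> /affinely_independent_unitmx uT u v.
have D0 : cross u v != 0 by rewrite cross_vertex -unitfE -unitmxE.
have u0 : 0 < enorm u.
  rewrite lt_neqAle enorm_ge0 andbT eq_sym enorm_eq0; apply: contra_neq D0 => ->.
  by rewrite /cross !mxE !mul0r subrr.
have v0 : 0 < enorm v.
  rewrite lt_neqAle enorm_ge0 andbT eq_sym enorm_eq0; apply: contra_neq D0 => ->.
  by rewrite /cross !mxE !mulr0 subrr.
have bnd : -1 <= dot u v / (enorm u * enorm v) <= 1.
  rewrite ler_pdivlMr ?ler_pdivrMr ?mulr_gt0// mul1r dot_le_enorm andbT mulN1r lerNl.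
  by rewrite -mulN1r -dotZl scaleN1r; apply: le_trans (dot_le_enorm _ _) _;
    rewrite /enorm -scaleN1r dotZl dotC dotZl mulrA mulrNN !mul1r.
split=> //; first by rewrite /interior_angle acos_ge0// acos_lepi.
by rewrite /interior_angle acosK// in_itv.
Qed.

Lemma interior_angle_le T i k : affinely_independent T -> -1 <= k <= 1 ->
  let u := row (ordS i) T - row i T in
  let v := row (ordS (ordS i)) T - row i T in
  (interior_angle T i <= acos k) = (k * (enorm u * enorm v) <= dot u v).
Proof.
move=> aT k1 u v; have [u0 v0 ang cosE] := cos_interior_angle i aT.
rewrite -ler_pdivlMr ?mulr_gt0// -cosE -{2}[k]acosK ?in_itv//.
by rewrite leNgt -ltr_cos ?in_itv//= -?leNgt// acos_ge0// acos_lepi.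
Qed.

Lemma maximum_angle_le T k : affinely_independent T -> -1 <= k <= 1 ->
  maximum_angle T <= acos k <->
  forall i, k * (enorm (row (ordS i) T - row i T)
                 * enorm (row (ordS (ordS i)) T - row i T))
    <= dot (row (ordS i) T - row i T) (row (ordS (ordS i)) T - row i T).
Proof.
move=> aT k1; rewrite /maximum_angle; split=> [le_k i|le_k].
  rewrite -interior_angle_le//; apply: le_trans le_k.
  by rewrite (bigD1 i)//= le_max lexx.
elim/big_ind: _ => [|x y x1 y1|i _]; first by rewrite acos_ge0.
  by rewrite ge_max x1.
by rewrite interior_angle_le.
Qed.

End Triangle.

(** * The maximum-angle condition *)

Section Angles.
Variable (R : realType).
Implicit Types (T : 'M[R]_(3, 2)).

(** The square of 2 R sin theta = o, for the angle theta at the vertex i and the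
    opposite edge o, multiplied by q^2; q^2 sin^2 theta is the difference on the
    left. *)
Lemma law_of_sines T i : affinely_independent T ->
  let u := row (ordS i) T - row i T in
  let v := row (ordS (ordS i)) T - row i T in
  let q := enorm u * enorm v in
  4 * circumradius T ^+ 2 * (q ^+ 2 - dot u v ^+ 2)
    = q ^+ 2 * edist (row (ordS i) T) (row (ordS (ordS i)) T) ^+ 2.
Proof.
move=> aT u v q.
have qE : q ^+ 2 = dot u u * dot v v by rewrite /q exprMn !enorm_sqr.
have -> : q ^+ 2 - dot u v ^+ 2 = \det (edge_mx T) ^+ 2.
  by rewrite qE -dot_cross cross_vertex; ring.
have := circumradius_sqr i aT; rewrite /= -/u -/v -qE => ->.
by rewrite /edist enorm_sqr /u /v opprB addrA subrK.
Qed.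

Lemma edist_cosines T i :
  let u := row (ordS i) T - row i T in
  let v := row (ordS (ordS i)) T - row i T in
  edist (row (ordS i) T) (row (ordS (ordS i)) T) ^+ 2
    = enorm u ^+ 2 + enorm v ^+ 2 - 2 * dot u v.
Proof.
move=> u v; rewrite !enorm_sqr -dotBB.
by rewrite /u /v opprB addrA subrK.
Qed.

(** An obtuse angle is opposite to a longest edge, so that its sine is
    h / (2 R), which is at least 1 / (2 C); this bounds its cosine away
    from -1. *)
Lemma semiregular_angle T (C : R) i : affinely_independent T -> 0 < C ->
  circumradius T <= C * diam (hull T) ->
  let u := row (ordS i) T - row i T in
  let v := row (ordS (ordS i)) T - row i T in
  - Num.sqrt (1 - (2 * C) ^- 2) * (enorm u * enorm v) <= dot u v.
Proof.
move=> aT C0 RC /=.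
set u := row (ordS i) T - _; set v := row (ordS (ordS i)) T - _.
have [u0 v0 _ _] := cos_interior_angle i aT; rewrite -/u -/v in u0 v0.
have q0 := mulr_gt0 u0 v0; set q := enorm u * enorm v in q0 *.
set s := Num.sqrt _; have s0 : 0 <= s by exact: sqrtr_ge0.
have [t0|t0] := leP 0 (dot u v).
  by apply: le_trans t0; rewrite mulNr oppr_le0 mulr_ge0// ltW.
have sines := law_of_sines i aT; rewrite -/u -/v -/q in sines.
have cosines : _ = _ := edist_cosines T i; rewrite -/u -/v in cosines.
set o := edist _ _ in sines cosines.
have o0 : 0 <= o by exact: enorm_ge0.
have ou : enorm u <= o.
  by rewrite -ler_sqr ?nnegrE ?(ltW u0)// cosines; have := sqr_ge0 (enorm v); lra.
have ov : enorm v <= o.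
  by rewrite -ler_sqr ?nnegrE ?(ltW v0)// cosines; have := sqr_ge0 (enorm u); lra.
have ho : diam (hull T) <= o by exact: (@diam_vertex _ T i).
have op : 0 < o by exact: lt_le_trans ou.
have Ro : circumradius T <= C * o by apply: le_trans RC _; rewrite ler_pM2l.
have R0 := circumradius_ge0 aT.
have R2 : circumradius T ^+ 2 <= (C * o) ^+ 2 by rewrite ler_sqr ?nnegrE// mulr_ge0// ltW.
have t2 : dot u v ^+ 2 <= q ^+ 2.
  by rewrite /q exprMn !enorm_sqr -dot_cross lerDl sqr_ge0.
have key : q ^+ 2 <= (2 * C) ^+ 2 * (q ^+ 2 - dot u v ^+ 2).
  have o2 : 0 < o ^+ 2 by rewrite exprn_gt0.
  rewrite -(ler_pM2r o2) -sines.
  have -> : (2 * C) ^+ 2 * (q ^+ 2 - dot u v ^+ 2) * o ^+ 2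
     = 4 * (C * o) ^+ 2 * (q ^+ 2 - dot u v ^+ 2) by ring.
  by rewrite ler_wpM2r ?subr_ge0// ler_pM2l.
have C2 : 0 < (2 * C) ^+ 2 by rewrite exprn_gt0// mulr_gt0.
have bnd : dot u v ^+ 2 <= (1 - (2 * C) ^- 2) * q ^+ 2.
  have : q ^+ 2 / (2 * C) ^+ 2 <= q ^+ 2 - dot u v ^+ 2 by rewrite ler_pdivrMr// mulrC.
  by rewrite mulrBl mul1r [_ ^- 2 * _]mulrC; lra.
have q2 : 0 < q ^+ 2 by rewrite exprn_gt0.
have s2 : 0 <= 1 - (2 * C) ^- 2.
  by rewrite -(pmulr_lge0 _ q2); apply: le_trans (sqr_ge0 _) bnd.
rewrite mulNr lerNl -ler_sqr ?nnegrE ?oppr_ge0 ?(ltW t0)//; last by rewrite mulr_ge0// ltW.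
by rewrite sqrrN exprMn sqr_sqrtr.
Qed.

(** At the vertex opposite to a longest edge the cosine is at most 1/2 by the
    law of cosines, and at least k, so the squared sine is at least
    1 - max(k^2, 1/4); and R = h / (2 sin theta) there. *)
Lemma angle_semiregular T (k : R) : affinely_independent T ->
  (forall i, k * (enorm (row (ordS i) T - row i T)
                 * enorm (row (ordS (ordS i)) T - row i T))
    <= dot (row (ordS i) T - row i T) (row (ordS (ordS i)) T - row i T)) ->
  let M := Num.max (k ^+ 2) 4^-1 in
  M < 1 -> circumradius T <= (2 * Num.sqrt (1 - M))^-1 * diam (hull T).
Proof.
move=> aT angles M M1.
pose opp (i : 'I_3) := edist (row (ordS i) T) (row (ordS (ordS i)) T).
pose i := [arg max_(i > ord0) opp i]%O.
have imax j : opp j <= opp i.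
  by rewrite /i; case: Order.TotalTheory.arg_maxP => // l _; apply.
have := angles i; have sines := law_of_sines i aT.
have cosines : _ = _ := edist_cosines T i.
have [u0 v0 _ _] := cos_interior_angle i aT.
set u := row (ordS i) T - row i T in u0 sines cosines *.
set v := row (ordS (ordS i)) T - row i T in v0 sines cosines *.
rewrite -/(opp i) in sines cosines.
have q0 := mulr_gt0 u0 v0; set q := enorm u * enorm v in q0 sines *.
set t := dot u v in sines cosines * => kt.
have uo : enorm u <= opp i.
  by have := imax (ordS (ordS i)); rewrite /opp ordS3 edistC.
have vo : enorm v <= opp i by have := imax (ordS i); rewrite /opp ordS3.
have oh : opp i <= diam (hull T) by exact: edist_le_diam.
have tq : t <= q / 2.
  have u2 : enorm u ^+ 2 <= opp i ^+ 2 by rewrite ler_sqr ?nnegrE ?enorm_ge0.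
  have v2 : enorm v ^+ 2 <= opp i ^+ 2 by rewrite ler_sqr ?nnegrE ?enorm_ge0.
  have [uv|vu] := leP (enorm u) (enorm v).
    have : enorm u * enorm u <= q by rewrite ler_pM2l.
    by rewrite -expr2; lra.
  have : enorm v * enorm v <= q by rewrite ler_pM2r// ltW.
  by rewrite -expr2; lra.
have tM : t ^+ 2 <= M * q ^+ 2.
  have q2 : 0 <= q ^+ 2 by rewrite sqr_ge0.
  have [t0|t0] := leP 0 t.
    have : t ^+ 2 <= (q / 2) ^+ 2 by rewrite ler_sqr ?nnegrE// divr_ge0// ltW.
    move=> /le_trans; apply; rewrite exprMn mulrC ler_wpM2r//.
    by rewrite /M le_max; apply/orP; right; lra.
  have : (- t) ^+ 2 <= (- (k * q)) ^+ 2 by rewrite ler_sqr ?nnegrE; lra.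
  rewrite !sqrrN => /le_trans; apply; rewrite exprMn ler_wpM2r//.
  by rewrite /M le_max lexx.
have R0 := circumradius_ge0 aT.
have s0 : 0 < Num.sqrt (1 - M) by rewrite sqrtr_gt0 subr_gt0.
have d0 : 0 <= diam (hull T) by apply: le_trans oh; exact: enorm_ge0.
rewrite mulrC ler_pdivlMr ?mulr_gt0// -ler_sqr ?nnegrE ?mulr_ge0 ?(ltW s0)//.
have -> : (circumradius T * (2 * Num.sqrt (1 - M))) ^+ 2
    = 4 * circumradius T ^+ 2 * (1 - M).
  by rewrite !exprMn sqr_sqrtr ?subr_ge0 ?(ltW M1)//; ring.
have : opp i ^+ 2 <= diam (hull T) ^+ 2 by rewrite ler_sqr ?nnegrE ?enorm_ge0.
apply: le_trans; have q2 : 0 < q ^+ 2 by rewrite exprn_gt0.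
rewrite -(ler_pM2l q2) -sines.
have -> : q ^+ 2 * (4 * circumradius T ^+ 2 * (1 - M))
   = 4 * circumradius T ^+ 2 * (q ^+ 2 - M * q ^+ 2) by ring.
by apply: ler_wpM2l; [rewrite mulr_ge0 ?sqr_ge0|exact: lerB].
Qed.

End Angles.

Lemma semiregular_maximum_angle_condition (R : realType) (I : Type)
    (Th : I -> set 'M[R]_(3, 2)) :
  (forall i T, Th i T -> affinely_independent T) ->
  semiregular Th <-> maximum_angle_condition Th.
Proof.
move=> aTh; split=> [[C [C0 CT]]|[delta [d0 dpi dT]]].
- pose k := - Num.sqrt (1 - (2 * C) ^- 2).
  have s1 : Num.sqrt (1 - (2 * C) ^- 2) < 1.
    by rewrite -[ltRHS]sqrtr1 ltr_sqrt// gtrBl invr_gt0 exprn_gt0// mulr_gt0.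
  have s0 : 0 <= Num.sqrt (1 - (2 * C) ^- 2) by exact: sqrtr_ge0.
  have k1 : -1 < k by rewrite /k ltrN2.
  have k2 : k <= 0 by rewrite /k oppr_le0.
  exists (acos k); split.
  + by rewrite acos_gt0//; lra.
  + by rewrite acos_ltpi//; lra.
  + move=> i T0 T0h; apply/maximum_angle_le; [exact: aTh T0h|lra|].
    by move=> j; apply: semiregular_angle (CT _ _ T0h) => //; exact: aTh T0h.
- pose k := cos delta.
  have dI : delta \in `[0, pi] by rewrite in_itv/= !ltW.
  have k1 : -1 < k by rewrite /k -cospi ltr_cos// in_itv/= lexx pi_ge0.
  have k2 : k < 1 by rewrite /k -cos0 ltr_cos// in_itv/= lexx pi_ge0.
  have kk : k ^+ 2 < 1.
    by have : 0 < (1 - k) * (1 + k); [apply: mulr_gt0; lra|rewrite expr2; lra].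
  have M1 : Num.max (k ^+ 2) 4^-1 < 1 by rewrite gt_max kk/=; lra.
  exists (2 * Num.sqrt (1 - Num.max (k ^+ 2) 4^-1))^-1; split.
    by rewrite invr_gt0 mulr_gt0// sqrtr_gt0 subr_gt0.
  move=> i T0 T0h; apply: angle_semiregular => //; first exact: aTh T0h.
  apply/maximum_angle_le; [exact: aTh T0h|lra|].
  by rewrite /k cosK//; exact: dT T0h.
Qed.

Theorem lemma3 (R : realType) :
  (exists c1 c2 : R, [/\ 0 < c1, 0 < c2 &
     forall (Omega : set 'rV[R]_2) (Th : set 'M[R]_(3, 2)),
       bounded_polyhedral_domain Omega -> simplicial_mesh Omega Th ->
     forall T0, Th T0 ->
     forall (a1 a2 : R) (T : 'M[R]_(3, 2)),
       standard_position2 a1 a2 T -> congruent T0 T ->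
       c1 * H2 T0 <= standard_H2 a1 a2 T <= c2 * H2 T0]) /\
  (exists c1 c2 : R, [/\ 0 < c1, 0 < c2 &
     forall (Omega : set 'rV[R]_3) (Th : set 'M[R]_(4, 3)),
       bounded_polyhedral_domain Omega -> simplicial_mesh Omega Th ->
     forall T0, Th T0 ->
     forall (a1 a2 a3 : R) (T : 'M[R]_(4, 3)),
       standard_position3 a1 a2 a3 T -> congruent T0 T ->
       c1 * H3 T0 <= standard_H3 a1 a2 a3 T <= c2 * H3 T0]) /\
  (exists c3 c4 : R, [/\ 0 < c3, 0 < c4 &
     forall (Omega : set 'rV[R]_2) (Th : set 'M[R]_(3, 2)),
       bounded_polyhedral_domain Omega -> simplicial_mesh Omega Th ->
     forall T0, Th T0 ->
       c3 * circumradius T0 <= H2 T0 <= c4 * circumradius T0]) /\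
  (forall (Omega : set 'rV[R]_2) (I : Type) (Th : I -> set 'M[R]_(3, 2)),
     bounded_polyhedral_domain Omega ->
     (forall i, simplicial_mesh Omega (Th i)) ->
     (H_over_h_bounded Th -> semiregular Th) /\
     (semiregular Th <-> maximum_angle_condition Th)).
Proof.
have K0 := area_triangle_gt0 R.
split; [|split; [|split]].
- exists 2^-1, 1; split; [by rewrite invr_gt0|by []|].
  move=> Omega Th _ mesh T0 T0h a1 a2 T std cong.
  rewrite (congruent_H2 (mesh_nondegenerate mesh T0h) cong).
  exact: standard_H2_equiv.
- exists 2^-1, 2; split; [by rewrite invr_gt0|by []|].
  move=> Omega Th _ mesh T0 T0h a1 a2 a3 T std cong.
  rewrite (congruent_H3 (mesh_nondegenerate mesh T0h) cong).
  exact: standard_H3_equiv.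
- exists (2 / fine (mu2 (@triangle R))), (4 / fine (mu2 (@triangle R))).
  split; [by rewrite divr_gt0|by rewrite divr_gt0|].
  move=> Omega Th _ mesh T0 T0h.
  exact: H2_circumradius (mesh_nondegenerate mesh T0h).
- move=> Omega I Th _ mesh.
  have aTh i T : Th i T -> affinely_independent T.
    exact: mesh_nondegenerate (mesh i) T.
  split; last exact: semiregular_maximum_angle_condition.
  move=> [C HC]; set K := fine _ in K0.
  have C'0 : 0 < Num.max C 1 by rewrite lt_max ltr01 orbT.
  exists (K / 2 * Num.max C 1); split; first by rewrite mulr_gt0// divr_gt0.
  move=> i T0 T0h; have aT := aTh _ _ T0h.
  have [u0 _ _ _] := cos_interior_angle ord0 aT.
  have h0 : 0 < diam (hull T0) by apply: lt_le_trans u0 _; exact: edist_le_diam.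
  have := HC _ _ T0h; rewrite ler_pdivrMr// => Hh.
  have /andP[RH _] := H2_circumradius aT.
  have : 2 / K * circumradius T0 <= Num.max C 1 * diam (hull T0).
    apply: le_trans RH (le_trans Hh _); rewrite ler_pM2r// le_max lexx//.
  rewrite -ler_pdivlMl ?divr_gt0// invf_div => /le_trans; apply.
  by rewrite mulrA.
Qed.
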